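(* Let $k\ge2$ and let $\omega\in\mathbb C$ be such that $2b+\omega-4\neq0$ for $b=2,\dots,k$. The element $$s_{(k)}=\frac1{k!}\prod_{b=2}^k\frac{(y_b+1)(y_b+\omega+b-3)}{2b+\omega-4}\in\mathcal B_k(\omega)$$ satisfies $$\sigma_as_{(k)}=s_{(k)}\sigma_a=s_{(k)},\qquad \epsilon_as_{(k)}=s_{(k)}\epsilon_a=0\quad(a=1,\dots,k-1),\qquad \varepsilon(s_{(k)})=1.$$ Hence the operators $$S_{(k)}=\rho(s_{(k)})=\frac1{k!}\prod_{b=2}^k\frac{(Y_b+1)(Y_b+n+b-3)}{2b+n-4}\qquad(k\ge2),$$ (with $\omega=n$) and, for $n=2r$, $$A_{(k)}=\widetilde\rho(s_{(k)})=\frac1{k!}\prod_{b=2}^k\frac{(\widetilde Y_b+1)(\widetilde Y_b-n+b-3)}{2b-n-4}\qquad(2\le k\le r+1)$$ (with $\omega=-n$) are the $k$-th $S$-operator for the idempotent $B_n$ and the $k$-th $A$-operator for the idempotent $\widetilde B_n$ respectively.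
   Context: Brauer algebra: $\mathcal B_k(\omega)$ is the unital $\mathbb C$-algebra generated by $\sigma_1,\dots,\sigma_{k-1},\epsilon_1,\dots,\epsilon_{k-1}$ with relations $\sigma_a^2=1$, $\epsilon_a^2=\omega\epsilon_a$, $\sigma_a\epsilon_a=\epsilon_a\sigma_a=\epsilon_a$; $\sigma_a\sigma_b=\sigma_b\sigma_a$, $\epsilon_a\epsilon_b=\epsilon_b\epsilon_a$, $\sigma_a\epsilon_b=\epsilon_b\sigma_a$ for $|a-b|>1$; $\sigma_a\sigma_{a+1}\sigma_a=\sigma_{a+1}\sigma_a\sigma_{a+1}$, $\epsilon_a\epsilon_{a+1}\epsilon_a=\epsilon_a$, $\epsilon_{a+1}\epsilon_a\epsilon_{a+1}=\epsilon_{a+1}$, $\sigma_a\epsilon_{a+1}\epsilon_a=\sigma_{a+1}\epsilon_a$, $\epsilon_{a+1}\epsilon_a\sigma_{a+1}=\epsilon_{a+1}\sigma_a$. The $\sigma_a$ generate a copy of $\mathbb C[\mathbf S_k]$ ($\sigma_a$ = transposition $(a,a+1)$). The augmentation $\varepsilon\colon\mathcal B_k(\omega)\to\mathbb C$ is the homomorphism with $\varepsilon(\sigma_a)=1$, $\varepsilon(\epsilon_a)=0$. For $a<b$ let $\tau_{ab}=\sigma_a\sigma_{a+1}\cdots\sigma_{b-1}$ (with $\tau_{aa}=1$), $\sigma_{ab}=\tau_{a,b-1}\sigma_{b-1}\tau_{a,b-1}^{-1}$, $\epsilon_{ab}=\tau_{a,b-1}\epsilon_{b-1}\tau_{a,b-1}^{-1}$,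 and $y_b=\sum_{a=1}^{b-1}(\sigma_{ab}-\epsilon_{ab})$ (these elements commute with each other). Let $i'=n-i+1$. $P_n(v\otimes w)=w\otimes v$ and $Q_n=\sum_{i,j=1}^nE_i{}^j\otimes E_{i'}{}^{j'}$ on $\mathbb C^n\otimes\mathbb C^n$ ($E_i{}^j$ matrix units). For $n=2r$, let $\varepsilon_i=1$ for $i\le r$, $\varepsilon_i=-1$ for $i>r$, and $\widetilde Q_n=\sum_{i,j}\varepsilon_i\varepsilon_jE_i{}^j\otimes E_{i'}{}^{j'}$. The idempotents are $B_n=\frac{1-P_n}2+\frac{Q_n}n$ and (for $n=2r$) $\widetilde B_n=\frac{1-P_n}2-\frac{\widetilde Q_n}n$. The homomorphisms $\rho\colon\mathcal B_k(n)\to\mathrm{End}((\mathbb C^n)^{\otimes k})$ and $\widetilde\rho\colon\mathcal B_k(-n)\to\mathrm{End}((\mathbb C^n)^{\otimes k})$ are given by $\rho(\sigma_a)=P_n^{(a,a+1)}$, $\rho(\epsilon_a)=Q_n^{(a,a+1)}$, $\widetilde\rho(\sigma_a)=-P_n^{(a,a+1)}$, $\widetilde\rho(\epsilon_a)=-\widetilde Q_n^{(a,a+1)}$, where $T^{(a,b)}$ acts as $T$ in tensor factors $a,b$. $Y_b=\rho(y_b)=\sum_{a=1}^{b-1}(P_n^{(ab)}-Q_n^{(ab)})$, $\widetilde Y_b=\widetilde\rho(y_b)=-\sum_{a=1}^{b-1}(P_n^{(ab)}-\widetilde Q_n^{(ab)})$. For an idempotent $A\in\mathrm{End}(\mathbb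 C^n\otimes\mathbb C^n)$, $S=1-A$, with entries $A(e_i\otimes e_j)=\sum A^{kl}_{ij}e_k\otimes e_l$: let $\mathfrak X_A(\mathbb C)$ be the algebra with generators $x^1,\dots,x^n$ and relations $\sum_{i,j}A^{kl}_{ij}x^ix^j=0$; $\mathfrak X^*_A(\mathbb C)$: generators $x_i$, relations $\sum_{i,j}x_ix_jA^{ij}_{kl}=0$; $\Xi_A(\mathbb C)$: generators $\psi_i$, relations $\psi_i\psi_j=\sum A^{kl}_{ij}\psi_k\psi_l$; $\Xi^*_A(\mathbb C)$: generators $\psi^i$, relations $\psi^i\psi^j=\sum A^{ij}_{kl}\psi^k\psi^l$. Put $X=\sum x^ie_i$, $X^*=\sum x_ie^i$, $\Psi=\sum\psi_ie^i$, $\Psi^*=\sum\psi^ie_i$, where $(e^i)$ is the dual basis of rows; $X\otimes\cdots\otimes X=\sum x^{i_1}\cdots x^{i_k}e_{i_1}\otimes\cdots\otimes e_{i_k}$, etc. ($k$ factors). $S_{(k)}$ is the $k$-th $S$-operator for $A$ if $A^{(a,a+1)}S_{(k)}=S_{(k)}A^{(a,a+1)}=0$ ($1\le a\le k-1$), $(X^*\otimes\cdots\otimes X^* )S_{(k)}=X^*\otimes\cdots\otimes X^*$, $S_{(k)}(X\otimes\cdots\otimes X)=X\otimes\cdots\otimes X$. $A_{(k)}$ is the $k$-th $A$-operator for $A$ if $S^{(a,a+1)}A_{(k)}=A_{(k)}S^{(a,a+1)}=0$ ($1\le a\le k-1$), $(\Psi\otimes\cdots\otimes\Psi)A_{(k)}=\Psi\otimes\cdots\otimes\Psi$,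 $A_{(k)}(\Psi^*\otimes\cdots\otimes\Psi^* )=\Psi^*\otimes\cdots\otimes\Psi^*$. *)

(* Defs.v *)
From HB Require Import structures.
From mathcomp Require Import all_boot all_order all_algebra.
From mathcomp Require Import fingroup perm generic_quotient ring_quotient.
From mathcomp Require Import boolp reals.
From mathcomp Require Import zify finmap monalg complex mxtens.

Set Implicit Arguments.
Unset Strict Implicit.
Unset Printing Implicit Defensive.

Import Order.TTheory GRing.Theory Num.Theory.

Local Open Scope ring_scope.
Local Open Scope quotient_scope.

Section FreeAlgebra.
Variables (K : fieldType) (I : choiceType).
Local Notation F := {malg K[{fmonom I}]}.

Fact fgen_key : unit. Proof. exact: tt. Qed.
Definition fgen : I -> F := locked_with fgen_key (fun i => << fmu i >>).

Lemma fscaleAr (c : K) (x y : F) : c *: (x * y) = x * (c *: y).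
Proof.
have cP z : c *: z = z * << c *g mone >>.
  by rewrite malgM_def fgmulgU malgZ_def; apply: eq_bigr => m _; rewrite mulm1 mulrC.
by rewrite !cP mulrA.
Qed.

Section Eval.
Variables (A : pzRingType) (f : {rmorphism K -> A}) (g : I -> A).

Definition fword (m : {fmonom I}) : A := \prod_(i <- (m : seq I)) g i.

(* The structure map f of the algebra A is explicit because square matrices of
   unspecified size are only a pzRingType, hence not an algType. *)
Definition feval (x : F) : A := \sum_(m <- msupp x) f x@_m * fword m.

Lemma fwordM m1 m2 : fword (mmul m1 m2) = fword m1 * fword m2.
Proof. by rewrite /fword fmM big_cat. Qed.

Lemma fword1 : fword mone = 1.
Proof. by rewrite /fword fm1 big_nil. Qed.

Lemma fevalEw (d : {fset {fmonom I}}) x : (msupp x `<=` d)%fset ->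
  feval x = \sum_(m <- d) f x@_m * fword m.
Proof.
move=> le; rewrite [LHS](big_fset_incl _ le) //= => m _ /mcoeff_outdom ->.
by rewrite rmorph0 mul0r.
Qed.

Lemma fevalU c m : feval << c *g m >> = f c * fword m.
Proof. by rewrite (fevalEw msuppU_le) big_seq_fset1 mcoeffUU. Qed.

Lemma feval_is_zmod_morphism : zmod_morphism feval.
Proof.
move=> x y.
have le1 : (msupp x `<=` msupp x `|` msupp y)%fset by rewrite fsubsetUl.
have le2 : (msupp y `<=` msupp x `|` msupp y)%fset by rewrite fsubsetUr.
rewrite (fevalEw le1) (fevalEw le2) (fevalEw (msuppB_le x y)) -sumrB.
by apply: eq_bigr => m _; rewrite mcoeffB rmorphB mulrBl.
Qed.

HB.instance Definition _ := GRing.isZmodMorphism.Build F A feval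
  feval_is_zmod_morphism.

Lemma feval_gen i : feval (fgen i) = g i.
Proof. by rewrite /fgen unlock fevalU rmorph1 mul1r /fword fmU big_seq1. Qed.

Lemma feval1 : feval 1 = 1.
Proof. by rewrite fevalU rmorph1 mul1r fword1. Qed.

Hypothesis fC : forall c x, GRing.comm (f c) x.

Lemma fevalM x y : feval (x * y) = feval x * feval y.
Proof.
rewrite malgME raddf_sum mulr_suml; apply: eq_bigr => m1 _.
rewrite raddf_sum mulr_sumr; apply: eq_bigr => m2 _.
rewrite /= fevalU fwordM rmorphM -!mulrA; congr (_ * _).
by rewrite !mulrA fC.
Qed.

Lemma fevalZ c x : feval (c *: x) = f c * feval x.
Proof. by rewrite -mul_malgC fevalM fevalU fword1 mulr1. Qed.

End Eval.

(* Generators and relations x = y for the pairs with prel x y, together with a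
   character of the free algebra compatible with these relations: it ensures
   that the presented algebra is not zero, and descends to its augmentation. *)
Record presentation := Presentation {
  prel : F -> F -> Prop;
  pchar : I -> K;
  pcharP : forall x y, prel x y ->
    feval (idfun : {rmorphism K -> K}) pchar x = feval idfun pchar y
}.

Variable P : presentation.

Inductive pideal : F -> Prop :=
| pideal_rel x y of prel P x y : pideal (x - y)
| pideal0 : pideal 0
| pidealB x y of pideal x & pideal y : pideal (x - y)
| pidealMl a x of pideal x : pideal (a * x)
| pidealMr a x of pideal x : pideal (x * a).

Definition pideal_pred : {pred F} := fun x => `[< pideal x >].

Lemma pidealP x : reflect (pideal x) (x \in pideal_pred).
Proof. exact: asboolP. Qed.

Lemma pideal_zmod_closed : zmod_closed pideal_pred.
Proof.
split=> [|x y /pidealP hx /pidealP hy]; apply/pidealP; first exact: pideal0.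
exact: pidealB.
Qed.

HB.instance Definition _ := GRing.isZmodClosed.Build F pideal_pred
  pideal_zmod_closed.

Definition presented : Type := (Quotient.quot pideal_pred).

HB.instance Definition _ := GRing.Zmodule.on presented.

Definition ppi (x : F) : presented := \pi_(Quotient.quot pideal_pred) x.

Lemma ppi_is_zmod_morphism : zmod_morphism ppi.
Proof. by move=> x y; rewrite /ppi raddfB. Qed.

HB.instance Definition _ := GRing.isZmodMorphism.Build F presented ppi
  ppi_is_zmod_morphism.

Definition prepr (u : presented) : F := repr (u : (Quotient.quot pideal_pred)).

Lemma preprK : cancel prepr ppi.
Proof. by move=> u; rewrite /ppi /prepr reprK. Qed.

Lemma ppi_eqP x y : ppi x = ppi y <-> pideal (x - y).
Proof.
split=> [/eqP|/pidealP].
  by rewrite /ppi -Quotient.idealrBE => /pidealP.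
by rewrite Quotient.idealrBE => /eqP.
Qed.

Lemma ppi_rel x y : prel P x y -> ppi x = ppi y.
Proof. by move=> xy; apply/ppi_eqP/pideal_rel. Qed.

Lemma prepr_ppi x : pideal (prepr (ppi x) - x).
Proof. by apply/ppi_eqP; rewrite preprK. Qed.

(* The operations are locked, since unification would otherwise try to compare
   polynomial expressions by unfolding the free algebra. *)
Fact poperation_key : unit. Proof. exact: tt. Qed.
Definition pone : presented := locked_with poperation_key (ppi 1).
Definition pmul : presented -> presented -> presented :=
  locked_with poperation_key (fun u v => ppi (prepr u * prepr v)).
Definition pscale : K -> presented -> presented :=
  locked_with poperation_key (fun c u => ppi (c *: prepr u)).

Lemma ppi1 : ppi 1 = pone.
Proof. by rewrite /pone unlock. Qed.

Lemma ppiM x y : ppi (x * y) = pmul (ppi x) (ppi y).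
Proof.
rewrite /pmul unlock; apply/esym/ppi_eqP.
have -> : prepr (ppi x) * prepr (ppi y) - x * y =
  (prepr (ppi x) - x) * prepr (ppi y) - x * (y - prepr (ppi y)).
  by rewrite mulrBl mulrBr opprB addrA subrK.
rewrite -[y - _]opprB mulrN.
rewrite -[- (_ * _)]sub0r.
apply: pidealB; first exact/pidealMr/prepr_ppi.
by apply: pidealB; [exact: pideal0 | exact/pidealMl/prepr_ppi].
Qed.

Lemma ppiZ c x : ppi (c *: x) = pscale c (ppi x).
Proof.
rewrite /pscale unlock; apply/esym/ppi_eqP; rewrite -scalerBr -mul_malgC; apply: pidealMl.
exact: prepr_ppi.
Qed.

Lemma pchar_ideal x : pideal x -> feval (idfun : {rmorphism K -> K}) (pchar P) x = 0.
Proof.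
have cC : forall c x : K, GRing.comm (idfun c) x by move=> *; exact: mulrC.
elim=> {x} [x y xy||x y _ hx _ hy|a x _ hx|a x _ hx].
- by rewrite raddfB /= (pcharP xy) subrr.
- by rewrite raddf0.
- by rewrite raddfB /= hx hy subrr.
- by rewrite fevalM // hx mulr0.
- by rewrite fevalM // hx mul0r.
Qed.

Fact pmulA : associative pmul.
Proof.
by move=> u v w; rewrite -[u]preprK -[v]preprK -[w]preprK -!ppiM mulrA.
Qed.

Fact pmul1u : left_id pone pmul.
Proof. by move=> u; rewrite -[u]preprK -ppi1 -ppiM mul1r. Qed.

Fact pmulu1 : right_id pone pmul.
Proof. by move=> u; rewrite -[u]preprK -ppi1 -ppiM mulr1. Qed.

Fact pmulDl : left_distributive pmul +%R.
Proof.
move=> u v w; rewrite -[u]preprK -[v]preprK -[w]preprK -raddfD /= -!ppiM.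
by rewrite mulrDl raddfD.
Qed.

Fact pmulDr : right_distributive pmul +%R.
Proof.
move=> u v w; rewrite -[u]preprK -[v]preprK -[w]preprK -raddfD /= -!ppiM.
by rewrite mulrDr raddfD.
Qed.

Fact pone_neq0 : pone != 0.
Proof.
apply/eqP; rewrite -ppi1 -(raddf0 ppi) => /ppi_eqP.
by rewrite subr0 => /pchar_ideal /eqP; rewrite feval1 oner_eq0.
Qed.

HB.instance Definition _ := GRing.Zmodule_isNzRing.Build presented
  pmulA pmul1u pmulu1 pmulDl pmulDr pone_neq0.

Fact pscaleA a b u : pscale a (pscale b u) = pscale (a * b) u.
Proof. by rewrite -[u]preprK -!ppiZ scalerA. Qed.

Fact pscale1 : left_id 1 pscale.
Proof. by move=> u; rewrite -[u]preprK -ppiZ scale1r. Qed.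

Fact pscaleDr : right_distributive pscale +%R.
Proof.
move=> a u v; rewrite -[u]preprK -[v]preprK -raddfD /= -!ppiZ.
by rewrite scalerDr raddfD.
Qed.

Fact pscaleDl u : {morph pscale^~ u : a b / a + b}.
Proof. by move=> a b; rewrite -[u]preprK -!ppiZ scalerDl raddfD. Qed.

HB.instance Definition _ := GRing.Zmodule_isLmodule.Build K presented
  pscaleA pscale1 pscaleDr pscaleDl.

Fact pscaleAl (a : K) (u v : presented) : a *: (u * v) = (a *: u) * v.
Proof.
rewrite -[u]preprK -[v]preprK -[LHS]/(pscale a (pmul _ _)).
by rewrite -ppiM -ppiZ -[RHS]/(pmul (pscale a _) _) -ppiZ -ppiM scalerAl.
Qed.

HB.instance Definition _ := GRing.Lmodule_isLalgebra.Build K presented pscaleAl.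

Fact pscaleAr (a : K) (u v : presented) : a *: (u * v) = u * (a *: v).
Proof.
rewrite -[u]preprK -[v]preprK -[LHS]/(pscale a (pmul _ _)).
rewrite -ppiM -ppiZ -[RHS]/(pmul _ (pscale a _)) -ppiZ -ppiM.
by rewrite fscaleAr.
Qed.

HB.instance Definition _ := GRing.Lalgebra_isAlgebra.Build K presented pscaleAr.

Definition pgen (i : I) : presented := ppi (fgen i).

Fact ppi_is_monoid_morphism : monoid_morphism ppi.
Proof. by split; [exact: ppi1 | exact: ppiM]. Qed.

HB.instance Definition _ := GRing.isMonoidMorphism.Build F presented ppi
  ppi_is_monoid_morphism.

HB.instance Definition _ := GRing.isScalable.Build K F presented *:%R ppi ppiZ.

Section Lift.
Variables (A : pzRingType) (f : {rmorphism K -> A}) (g : I -> A).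

Definition compatible := (forall c x, GRing.comm (f c) x)
  /\ forall x y, prel P x y -> feval f g x = feval f g y.

Definition plift of compatible := fun u : presented => feval f g (prepr u).

Hypothesis H : compatible.

Lemma plift_ppi x : plift H (ppi x) = feval f g x.
Proof.
have [fC frel] := H.
suff feval0 y : pideal y -> feval f g y = 0.
  by apply/eqP; rewrite -subr_eq0 -raddfB /= feval0 //; apply: prepr_ppi.
elim=> {y} [y z yz||y z _ hy _ hz|a y _ hy|a y _ hy].
- by rewrite raddfB /= (frel _ _ yz) subrr.
- by rewrite raddf0.
- by rewrite raddfB /= hy hz subrr.
- by rewrite fevalM // hy mulr0.
- by rewrite fevalM // hy mul0r.
Qed.

Lemma plift_gen i : plift H (pgen i) = g i.
Proof. by rewrite plift_ppi feval_gen. Qed.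

Fact plift_is_zmod_morphism : zmod_morphism (plift H).
Proof.
move=> u v; rewrite -[u]preprK -[v]preprK -raddfB /= !plift_ppi.
exact: raddfB.
Qed.

Fact plift_is_monoid_morphism : monoid_morphism (plift H).
Proof.
split=> [|u v]; first by rewrite -(rmorph1 ppi) plift_ppi feval1.
rewrite -[u]preprK -[v]preprK -rmorphM /= !plift_ppi.
by apply: fevalM; case: H.
Qed.

HB.instance Definition _ := GRing.isZmodMorphism.Build presented A (plift H)
  plift_is_zmod_morphism.
HB.instance Definition _ := GRing.isMonoidMorphism.Build presented A (plift H)
  plift_is_monoid_morphism.

Lemma pliftZ c u : plift H (c *: u) = f c * plift H u.
Proof.
by rewrite -[u]preprK -linearZ /= !plift_ppi fevalZ //; case: H.
Qed.

End Lift.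

Fact paug_compatible : compatible (idfun : {rmorphism K -> K}) (pchar P).
Proof. by split; [move=> c x; apply: mulrC | exact: pcharP]. Qed.

Definition paug : presented -> K := plift paug_compatible.
HB.instance Definition _ := GRing.isZmodMorphism.Build presented K paug
  (plift_is_zmod_morphism paug_compatible).
HB.instance Definition _ := GRing.isMonoidMorphism.Build presented K paug
  (plift_is_monoid_morphism paug_compatible).

Lemma paugZ c u : paug (c *: u) = c * paug u.
Proof. exact: pliftZ. Qed.

Lemma paug_gen i : paug (pgen i) = pchar P i.
Proof. exact: plift_gen. Qed.

End FreeAlgebra.

Section BrauerAlgebra.
Variables (K : fieldType) (k : nat) (w : K).

(* Generators and tensor factors are numbered from 0 in ordinals: the ordinal a
   stands for the index a + 1.  The functions of a natural number below are
   numbered from 1, and vanish out of range. *)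
Local Notation gens := ('I_k.-1 + 'I_k.-1)%type.
Local Notation F := {malg K[{fmonom gens}]}.
Local Notation s a := (fgen K (inl a : gens)).
Local Notation e a := (fgen K (inr a : gens)).

Definition far (a b : 'I_k.-1) : bool := (a.+1 < b)%N || (b.+1 < a)%N.

Variant brauer_rel : F -> F -> Prop :=
| brauer_ss a : brauer_rel (s a * s a) 1
| brauer_ee a : brauer_rel (e a * e a) (w *: e a)
| brauer_se a : brauer_rel (s a * e a) (e a)
| brauer_es a : brauer_rel (e a * s a) (e a)
| brauer_ssC a b of far a b : brauer_rel (s a * s b) (s b * s a)
| brauer_eeC a b of far a b : brauer_rel (e a * e b) (e b * e a)
| brauer_seC a b of far a b : brauer_rel (s a * e b) (e b * s a)
| brauer_sss (a b : 'I_k.-1) of b = a.+1 :> nat :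
    brauer_rel (s a * s b * s a) (s b * s a * s b)
| brauer_eee (a b : 'I_k.-1) of b = a.+1 :> nat :
    brauer_rel (e a * e b * e a) (e a)
| brauer_eee' (a b : 'I_k.-1) of b = a.+1 :> nat :
    brauer_rel (e b * e a * e b) (e b)
| brauer_see (a b : 'I_k.-1) of b = a.+1 :> nat :
    brauer_rel (s a * e b * e a) (s b * e a)
| brauer_ees (a b : 'I_k.-1) of b = a.+1 :> nat :
    brauer_rel (e b * e a * s b) (e b * s a).

Record brauer_rep (A : pzRingType) (f : {rmorphism K -> A})
    (S E : 'I_k.-1 -> A) : Prop := BrauerRep {
  rep_ss a : S a * S a = 1;
  rep_ee a : E a * E a = f w * E a;
  rep_se a : S a * E a = E a;
  rep_es a : E a * S a = E a;
  rep_ssC a b : far a b -> S a * S b = S b * S a;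
  rep_eeC a b : far a b -> E a * E b = E b * E a;
  rep_seC a b : far a b -> S a * E b = E b * S a;
  rep_sss (a b : 'I_k.-1) : b = a.+1 :> nat -> S a * S b * S a = S b * S a * S b;
  rep_eee (a b : 'I_k.-1) : b = a.+1 :> nat -> E a * E b * E a = E a;
  rep_eee' (a b : 'I_k.-1) : b = a.+1 :> nat -> E b * E a * E b = E b;
  rep_see (a b : 'I_k.-1) : b = a.+1 :> nat -> S a * E b * E a = S b * E a;
  rep_ees (a b : 'I_k.-1) : b = a.+1 :> nat -> E b * E a * S b = E b * S a
}.

Definition rep_gen (A : pzRingType) (S E : 'I_k.-1 -> A) (g : gens) : A :=
  match g with inl a => S a | inr a => E a end.

Lemma brauer_rep_feval (A : pzRingType) (f : {rmorphism K -> A}) S E x y :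
  (forall c t, GRing.comm (f c) t) -> brauer_rep f S E -> brauer_rel x y ->
  feval f (rep_gen S E) x = feval f (rep_gen S E) y.
Proof.
move=> fC rep; set ev := feval _ _.
have evM u v u' v' : ev u = u' -> ev v = v' -> ev (u * v) = u' * v'.
  by move=> <- <-; exact: fevalM.
have evZ c u u' : ev u = u' -> ev (c *: u) = f c * u'.
  by move=> <-; exact: fevalZ.
have ev1 : ev 1 = 1 by exact: feval1.
have evs a : ev (s a) = S a by exact: feval_gen.
have eve a : ev (e a) = E a by exact: feval_gen.
have eq_ev u v u' v' : ev u = u' -> ev v = v' -> u' = v' -> ev u = ev v.
  by move=> -> -> ->.
have evM3 u v t u' v' t' : ev u = u' -> ev v = v' -> ev t = t' ->
    ev (u * v * t) = u' * v' * t'.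
  by move=> hu hv ht; exact: evM (evM _ _ _ _ hu hv) ht.
clearbody ev.
case=> [a|a|a|a|a b ab|a b ab|a b ab|a b ab|a b ab|a b ab|a b ab|a b ab].
- exact: eq_ev (evM _ _ _ _ (evs a) (evs a)) ev1 (rep_ss rep a).
- exact: eq_ev (evM _ _ _ _ (eve a) (eve a)) (evZ _ _ _ (eve a)) (rep_ee rep a).
- exact: eq_ev (evM _ _ _ _ (evs a) (eve a)) (eve a) (rep_se rep a).
- exact: eq_ev (evM _ _ _ _ (eve a) (evs a)) (eve a) (rep_es rep a).
- exact: eq_ev (evM _ _ _ _ (evs a) (evs b)) (evM _ _ _ _ (evs b) (evs a))
    (rep_ssC rep ab).
- exact: eq_ev (evM _ _ _ _ (eve a) (eve b)) (evM _ _ _ _ (eve b) (eve a))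
    (rep_eeC rep ab).
- exact: eq_ev (evM _ _ _ _ (evs a) (eve b)) (evM _ _ _ _ (eve b) (evs a))
    (rep_seC rep ab).
- exact: eq_ev (evM3 _ _ _ _ _ _ (evs a) (evs b) (evs a))
    (evM3 _ _ _ _ _ _ (evs b) (evs a) (evs b)) (rep_sss rep ab).
- exact: eq_ev (evM3 _ _ _ _ _ _ (eve a) (eve b) (eve a)) (eve a) (rep_eee rep ab).
- exact: eq_ev (evM3 _ _ _ _ _ _ (eve b) (eve a) (eve b)) (eve b) (rep_eee' rep ab).
- exact: eq_ev (evM3 _ _ _ _ _ _ (evs a) (eve b) (eve a))
    (evM _ _ _ _ (evs b) (eve a)) (rep_see rep ab).
- exact: eq_ev (evM3 _ _ _ _ _ _ (eve b) (eve a) (evs b))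
    (evM _ _ _ _ (eve b) (evs a)) (rep_ees rep ab).
Qed.

Definition brauer_char : gens -> K := rep_gen (fun=> 1) (fun=> 0).

Fact brauer_charP x y : brauer_rel x y ->
  feval (idfun : {rmorphism K -> K}) brauer_char x = feval idfun brauer_char y.
Proof.
apply: brauer_rep_feval => [c t|]; first exact: mulrC.
by split=> *; rewrite ?(mulr0, mul0r, mulr1).
Qed.

Definition brauer_presentation := Presentation brauer_charP.

Definition brauer := presented brauer_presentation.
HB.instance Definition _ := GRing.Algebra.on brauer.

Definition bsigma (a : nat) : brauer :=
  \sum_(i < k.-1 | i.+1 == a) pgen brauer_presentation (inl i).
Definition beps (a : nat) : brauer :=
  \sum_(i < k.-1 | i.+1 == a) pgen brauer_presentation (inr i).

Lemma bsigma_ord (i : 'I_k.-1) :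
  bsigma i.+1 = pgen brauer_presentation (inl i).
Proof. by rewrite /bsigma (big_pred1 i) // => j /=; rewrite eqSS. Qed.

Lemma beps_ord (i : 'I_k.-1) :
  beps i.+1 = pgen brauer_presentation (inr i).
Proof. by rewrite /beps (big_pred1 i) // => j /=; rewrite eqSS. Qed.

Definition brauer_aug : brauer -> K := @paug K _ brauer_presentation.
HB.instance Definition _ := GRing.RMorphism.on brauer_aug.

Lemma brauer_aug_sigma (a : nat) : (0 < a < k)%N -> brauer_aug (bsigma a) = 1.
Proof.
case: a => //= a ak; have ak' : (a < k.-1)%N by rewrite -ltnS (ltn_predK ak).
by rewrite (bsigma_ord (Ordinal ak')) /brauer_aug paug_gen.
Qed.

Lemma brauer_aug_eps (a : nat) : (0 < a < k)%N -> brauer_aug (beps a) = 0.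
Proof.
case: a => //= a ak; have ak' : (a < k.-1)%N by rewrite -ltnS (ltn_predK ak).
by rewrite (beps_ord (Ordinal ak')) /brauer_aug paug_gen.
Qed.

Fact brauer_compatible (A : pzRingType) (f : {rmorphism K -> A}) S E :
  (forall c t, GRing.comm (f c) t) -> brauer_rep f S E ->
  compatible brauer_presentation f (rep_gen S E).
Proof. by move=> fC rep; split=> // x y; exact: brauer_rep_feval. Qed.

(* btauV a b is the inverse of btau a b; see btauK. *)
Definition btau (a b : nat) : brauer := \prod_(a <= c < b) bsigma c.
Definition btauV (a b : nat) : brauer :=
  \prod_(c <- rev (index_iota a b)) bsigma c.

Lemma bsigmaK (a : nat) : (0 < a < k)%N -> bsigma a * bsigma a = 1.
Proof.
case: a => //= a ak; have ak' : (a < k.-1)%N by rewrite -ltnS (ltn_predK ak).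
rewrite (bsigma_ord (Ordinal ak')) -(rmorphM (@ppi _ _ brauer_presentation)).
rewrite -(rmorph1 (@ppi _ _ brauer_presentation)); apply: ppi_rel.
exact: brauer_ss.
Qed.

Lemma btauK (a b : nat) : (0 < a)%N -> (b <= k)%N ->
  btau a b * btauV a b = 1 /\ btauV a b * btau a b = 1.
Proof.
move=> a0 bk; rewrite /btau /btauV.
have: all (fun c => (0 < c < k)%N) (index_iota a b).
  apply/allP => c; rewrite mem_index_iota => /andP[ac cb].
  by rewrite (leq_trans a0 ac) (leq_trans cb bk).
elim: (index_iota a b) => [|c r IH] /=; first by rewrite !big_nil mulr1.
move=> /andP[cP /IH[h1 h2]].
rewrite rev_cons -cats1 big_cat big_cons big_seq1; split.
  by rewrite -mulrA (mulrA _ _ (bsigma c)) h1 mul1r bsigmaK.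
by rewrite -mulrA (mulrA (bsigma c)) bsigmaK // mul1r h2.
Qed.

Definition bsigma2 (a b : nat) : brauer :=
  btau a b.-1 * bsigma b.-1 * btauV a b.-1.
Definition beps2 (a b : nat) : brauer :=
  btau a b.-1 * beps b.-1 * btauV a b.-1.

Definition bjucys (b : nat) : brauer :=
  \sum_(1 <= a < b) (bsigma2 a b - beps2 a b).

Definition brauer_sym : brauer :=
  (k`!%:R)^-1 *: \prod_(2 <= b < k.+1)
    ((2 * b%:R + w - 4)^-1 *:
      ((bjucys b + 1) * (bjucys b + (w + b%:R - 3)%:A))).

End BrauerAlgebra.
Section TensorSpace.
Variable K : fieldType.

(* The tensor power (K^n)^{\otimes k} has the basis e_I, where I runs over the
   multi-indices; operators are the matrices acting on columns of coordinates.
   The operators on K^n \otimes K^n are indexed instead by mxtens_index, as are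
   the products of tensmx. *)
Definition multi (k n : nat) := {ffun 'I_k -> 'I_n}.
Definition tdim (k n : nat) : nat := #|{: multi k n}|.

Definition Pop (n : nat) : 'M[K]_(n * n) :=
  \sum_(i < n) \sum_(j < n) delta_mx i j *t delta_mx j i.

Definition Qop (n : nat) : 'M[K]_(n * n) :=
  \sum_(i < n) \sum_(j < n) delta_mx i j *t delta_mx (rev_ord i) (rev_ord j).

Definition sgnC (r : nat) (i : 'I_(2 * r)) : K := if (i < r)%N then 1 else -1.

Definition Qtop (r : nat) : 'M[K]_(2 * r * (2 * r)) :=
  \sum_(i < 2 * r) \sum_(j < 2 * r)
    (sgnC i * sgnC j) *: (delta_mx i j *t delta_mx (rev_ord i) (rev_ord j)).

Definition Bop (n : nat) : 'M[K]_(n * n) :=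
  2^-1 *: (1%:M - Pop n) + n%:R^-1 *: Qop n.

Definition Btop (r : nat) : 'M[K]_(2 * r * (2 * r)) :=
  2^-1 *: (1%:M - Pop (2 * r)) - (2 * r)%:R^-1 *: Qtop r.

Section Factors.
Variables k n : nat.
Local Notation D := (tdim k n).

Definition opat_ord (a b : 'I_k) (T : 'M[K]_(n * n)) : 'M[K]_D :=
  \matrix_(p, q)
    let I : multi k n := enum_val p in let J : multi k n := enum_val q in
    T (mxtens_index (I a, I b)) (mxtens_index (J a, J b))
      *+ [forall c, (c != a) && (c != b) ==> (I c == J c)].

Definition opat (a b : nat) (T : 'M[K]_(n * n)) : 'M[K]_D :=
  \sum_(i < k | i.+1 == a) \sum_(j < k | j.+1 == b) opat_ord i j T.

Lemma opatE (i j : 'I_k) T : opat i.+1 j.+1 T = opat_ord i j T.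
Proof.
rewrite /opat (big_pred1 i) => [|i' /=]; last by rewrite eqSS.
by rewrite (big_pred1 j) // => j' /=; rewrite eqSS.
Qed.

End Factors.

Arguments opat k {n} a b T.

(* P_n and the operators Q_n, \widetilde Q_n are treated together: th is the
   family of signs and h the sign by which the Brauer generators are twisted. *)
Section Twisted.
Variables (k n : nat) (h : K) (th : 'I_n -> K).
Hypothesis h2 : h * h = 1.
Hypothesis th2 : forall i, th i * th i = 1.
Hypothesis threv : forall i, th (rev_ord i) = h * th i.
Local Notation mi := (multi k n).
Local Notation D := (tdim k n).

Definition Qth : 'M[K]_(n * n) :=
  \sum_(i < n) \sum_(j < n)
    (th i * th j) *: (delta_mx i j *t delta_mx (rev_ord i) (rev_ord j)).

Lemma PopE (i j l m : 'I_n) :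
  Pop n (mxtens_index (i, j)) (mxtens_index (l, m))
    = ((i == m) && (j == l))%:R.
Proof.
rewrite /Pop summxE (bigD1 i) //= [X in _ + X]big1 ?addr0 => [|i' ii']; last first.
  rewrite summxE big1 // => j' _.
  by rewrite tensmxE mxE eq_sym (negPf ii') mul0r.
rewrite summxE (bigD1 l) //= [X in _ + X]big1 ?addr0 => [|j' jl]; last first.
  by rewrite tensmxE mxE [l == _]eq_sym (negPf jl) andbF mul0r.
by rewrite tensmxE !mxE !eqxx mul1r andbC [m == i]eq_sym.
Qed.

Lemma QthE (i j l m : 'I_n) :
  Qth (mxtens_index (i, j)) (mxtens_index (l, m))
    = th i * th l * ((j == rev_ord i) && (m == rev_ord l))%:R.
Proof.
rewrite /Qth summxE (bigD1 i) //= [X in _ + X]big1 ?addr0 => [|i' ii']; last first.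
  rewrite summxE big1 // => j' _.
  by rewrite mxE tensmxE mxE eq_sym (negPf ii') mul0r mulr0.
rewrite summxE (bigD1 l) //= [X in _ + X]big1 ?addr0 => [|j' jl]; last first.
  by rewrite mxE tensmxE mxE [l == _]eq_sym (negPf jl) andbF mul0r mulr0.
by rewrite mxE tensmxE !mxE !eqxx mul1r.
Qed.

Definition ent (M : 'M[K]_D) (I J : mi) : K := M (enum_rank I) (enum_rank J).

Lemma entP (M N : 'M[K]_D) : (forall I J, ent M I J = ent N I J) -> M = N.
Proof.
move=> MN; apply/matrixP => p q.
by have := MN (enum_val p) (enum_val q); rewrite /ent !enum_valK.
Qed.

Lemma entM (M N : 'M[K]_D) I J : ent (M * N) I J = \sum_L ent M I L * ent N L J.
Proof.
rewrite /ent mxE (reindex (@enum_rank mi)) //=.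
exact: onW_bij (@enum_rank_bij mi).
Qed.

Lemma entZ c (M : 'M[K]_D) I J : ent (c *: M) I J = c * ent M I J.
Proof. by rewrite /ent mxE. Qed.

Lemma ent_opat a b T I J : ent (opat_ord a b T) I J =
  T (mxtens_index (I a, I b)) (mxtens_index (J a, J b))
      *+ [forall c, (c != a) && (c != b) ==> (I c == J c)].
Proof. by rewrite /ent mxE !enum_rankK. Qed.

Definition mperm (s : 'S_k) (I : mi) : mi := [ffun c => I (s c)].
Definition permop (s : 'S_k) : 'M[K]_D :=
  \matrix_(p, q) (enum_val q == mperm s (enum_val p))%:R.

Lemma ent_permop s M I J : ent (permop s * M) I J = ent M (mperm s I) J.
Proof.
rewrite entM (bigD1 (mperm s I)) //= big1 ?addr0 => [|L].
  by rewrite {1}/ent mxE !enum_rankK eqxx mul1r.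
by rewrite {1}/ent mxE !enum_rankK => /negPf ->; rewrite mul0r.
Qed.

Lemma permopM s t : permop s * permop t = permop (t * s)%g.
Proof.
apply: entP => I J; rewrite ent_permop /ent !mxE !enum_rankK.
congr (_ == _)%:R; apply/ffunP => c.
by rewrite !ffunE permM.
Qed.

Lemma permop1 : permop 1%g = 1.
Proof.
apply: entP => I J; rewrite -[LHS]/(ent _ I J) /ent !mxE !enum_rankK.
rewrite (inj_eq enum_rank_inj) eq_sym; congr (_ == _)%:R.
by apply/ffunP => c; rewrite ffunE perm1.
Qed.

Lemma opat_Pop a b : a != b -> opat_ord a b (Pop n) = permop (tperm a b).
Proof.
move=> ab; apply: entP => I J; rewrite ent_opat PopE /ent mxE !enum_rankK.
rewrite -mulrnA mulnb; congr (_%:R); congr nat_of_bool.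
apply/idP/eqP => [/andP[/andP[/eqP h1 /eqP h2'] /forallP h3]|->].
  apply/ffunP => c; rewrite ffunE; case: tpermP => [->|->|/eqP ca /eqP cb] //.
  by have := h3 c; rewrite ca cb => /eqP.
rewrite !ffunE tpermL tpermR !eqxx /=; apply/forallP => c; apply/implyP.
by move=> /andP[ca cb]; rewrite ffunE tpermD // eq_sym.
Qed.

Definition upd (I : mi) a b i j : mi :=
  [ffun c => if c == a then i else if c == b then j else I c].

Definition Qm (a b : 'I_k) : 'M[K]_D := opat_ord a b Qth.

Lemma ent_Qm a b M I J : a != b -> ent (Qm a b * M) I J =
  (I b == rev_ord (I a))%:R * th (I a) *
    \sum_l th l * ent M (upd I a b l (rev_ord l)) J.
Proof.
move=> ab; have ba : (b == a) = false by rewrite eq_sym (negPf ab).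
rewrite entM (partition_big (fun L : mi => L a) xpredT) //=.
rewrite mulr_sumr; apply: eq_bigr => l _.
rewrite (bigD1 (upd I a b l (rev_ord l))) /=; last by rewrite ffunE eqxx.
rewrite big1 ?addr0 => [|L /andP[/eqP La LU]].
  rewrite ent_opat QthE !ffunE !eqxx ba eqxx andbT.
  have -> : [forall c, (c != a) && (c != b) ==>
      (I c == upd I a b l (rev_ord l) c)].
    apply/forallP => c; apply/implyP => /andP[ca cb].
    by rewrite ffunE (negPf ca) (negPf cb).
  by rewrite mulr1n !mulrA; congr (_ * _); rewrite [LHS]mulrC mulrA.
rewrite ent_opat QthE La.
case: eqP => [Ib|]; last by rewrite mulr0 mul0rn mul0r.
case: eqP => [Lb|]; last by rewrite mulr0 mul0rn mul0r.
case: forallP => [LI|]; last by rewrite mulr0n mul0r.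
case/eqP: LU; apply/ffunP => c; rewrite ffunE.
case: eqP => [-> //|/eqP ca]; case: eqP => [-> //|/eqP cb].
by have := LI c; rewrite ca cb => /eqP ->.
Qed.

Lemma perm_neq (s : 'S_k) a b : a != b -> s a != s b.
Proof. by rewrite (inj_eq perm_inj). Qed.

Lemma permQ s a b : a != b -> permop s * Qm a b = Qm (s a) (s b) * permop s.
Proof.
move=> ab; apply: entP => I J; rewrite ent_permop -[Qm a b]mulr1.
rewrite ent_Qm // ent_Qm ?perm_neq // !ffunE; congr (_ * _).
apply: eq_bigr => l _; congr (_ * _).
rewrite -[permop s]mulr1 ent_permop; congr (ent _ _ _).
by apply/ffunP => c; rewrite !ffunE !(inj_eq perm_inj).
Qed.

Lemma sum_rev (F : 'I_n -> K) : \sum_l F l = \sum_l F (rev_ord l).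
Proof. by rewrite (reindex_inj rev_ord_inj). Qed.

Lemma QmC a b : a != b -> Qm b a = Qm a b.
Proof.
move=> ab; have ba : b != a by rewrite eq_sym.
apply: entP => I J; rewrite -[Qm a b]mulr1 -[Qm b a]mulr1 !ent_Qm //.
have -> : (I a == rev_ord (I b)) = (I b == rev_ord (I a)).
  by apply/eqP/eqP => ->; rewrite rev_ordK.
case: eqP => [->|]; last by rewrite !mul0r.
rewrite threv sum_rev !mul1r !mulr_sumr; apply: eq_bigr => l _.
rewrite threv rev_ordK !mulrA; congr (_ * ent _ _ _).
  by rewrite [h * _ * h]mulrAC h2 mul1r.
apply/ffunP => c; rewrite !ffunE.
by case: (eqVneq c b) => [->|cb] //; rewrite (negPf ba).
Qed.

Lemma QmP a b : a != b -> Qm a b * permop (tperm a b) = h *: Qm a b.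
Proof.
move=> ab; apply: entP => I J; rewrite entZ -[Qm a b in RHS]mulr1 !ent_Qm //.
rewrite mulrCA; congr (_ * _); rewrite sum_rev mulr_sumr; apply: eq_bigr => l _.
rewrite threv mulrA; congr (_ * _).
rewrite -[permop _]mulr1 ent_permop; congr (ent _ _ _).
apply/ffunP => c; rewrite !ffunE rev_ordK.
case: tpermP => [->|->|/eqP ca /eqP cb].
- by rewrite !eqxx [b == a]eq_sym (negPf ab).
- by rewrite !eqxx [b == a]eq_sym (negPf ab).
- by rewrite (negPf ca) (negPf cb).
Qed.

Lemma PQm a b : a != b -> permop (tperm a b) * Qm a b = h *: Qm a b.
Proof. by move=> ab; rewrite permQ // tpermL tpermR QmC // QmP. Qed.

Lemma QmQm a b : a != b -> Qm a b * Qm a b = n%:R *: Qm a b.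
Proof.
move=> ab; apply: entP => I J; rewrite entZ ent_Qm // -[Qm a b]mulr1.
transitivity ((I b == rev_ord (I a))%:R * th (I a) * \sum_(l < n)
   \sum_(m < n) th m * ent (1 : 'M_D) (upd I a b m (rev_ord m)) J).
  congr (_ * _); apply: eq_bigr => l _.
  rewrite ent_Qm // !ffunE !eqxx [b == a]eq_sym (negPf ab) eqxx mul1r mulrA th2 mul1r.
  apply: eq_bigr => m _; congr (_ * ent _ _ _).
  by apply/ffunP => c; rewrite !ffunE; case: eqP => // _; case: eqP.
by rewrite sumr_const card_ord [in RHS]ent_Qm // mulrnAr [RHS]mulr_natl.
Qed.

Lemma QmQm3 a b c : a != b -> b != c -> a != c ->
  Qm a b * Qm b c = Qm a b * permop (tperm a c).
Proof.
move=> ab bc ac; apply: entP => I J; rewrite !ent_Qm //; congr (_ * _).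
rewrite -[Qm b c]mulr1.
have [ba cb ca] : [/\ b != a, c != b & c != a].
  by rewrite eq_sym ab eq_sym bc eq_sym ac.
rewrite (bigD1 (I c)) //= [X in _ + X]big1 ?addr0 => [|l lc]; last first.
  rewrite ent_Qm // !ffunE (negPf ca) (negPf cb) (negPf ba) eqxx rev_ordK.
  by rewrite eq_sym (negPf lc) !mul0r mulr0.
rewrite ent_Qm // !ffunE (negPf ca) (negPf cb) (negPf ba) eqxx rev_ordK eqxx.
rewrite mul1r threv !mulrA [th _ * _]mulrC -[h * _ * _]mulrA th2 mulr1.
rewrite sum_rev mulr_sumr; apply: eq_bigr => l _.
rewrite threv !mulrA h2 mul1r; congr (_ * _).
rewrite -[permop _]mulr1 ent_permop; congr (ent _ _ _).
apply/ffunP => d; rewrite !ffunE rev_ordK.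
case: tpermP => [->|->|/eqP da /eqP dc].
- by rewrite (negPf ab) (negPf ac) eqxx (negPf ca) (negPf cb).
- by rewrite (negPf cb) !eqxx.
- by rewrite (negPf da) (negPf dc); case: eqP.
Qed.

Lemma QmQmC a b c d : a != b -> c != d -> a != c -> a != d -> b != c -> b != d ->
  Qm a b * Qm c d = Qm c d * Qm a b.
Proof.
move=> ab cd ac ad bc bd; apply: entP => I J.
have [ba dc ca] : [/\ b != a, d != c & c != a].
  by rewrite eq_sym ab eq_sym cd eq_sym ac.
have [da cb db] : [/\ d != a, c != b & d != b].
  by rewrite eq_sym ad eq_sym bc eq_sym bd.
rewrite -[Qm a b]mulr1 -[Qm c d]mulr1 -!mulrA !mul1r.
rewrite [in LHS]ent_Qm // [in RHS]ent_Qm //.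
under eq_bigr => l _.
  rewrite ent_Qm // !ffunE (negPf ca) (negPf cb) (negPf da) (negPf db).
  rewrite [th l * _]mulrCA mulr_sumr.
  over.
under [in RHS]eq_bigr => l _.
  rewrite ent_Qm // !ffunE (negPf ac) (negPf ad) (negPf bc) (negPf bd).
  rewrite [th l * _]mulrCA mulr_sumr.
  over.
rewrite -!mulr_sumr mulrCA; congr (_ * (_ * _)).
rewrite exchange_big; apply: eq_bigr => l _; apply: eq_bigr => m _ /=.
rewrite mulrCA; congr (_ * (_ * ent _ _ _)); apply/ffunP => x; rewrite !ffunE.
case: (eqVneq x c) => [->|xc]; first by rewrite (negPf ca) (negPf cb).
by case: (eqVneq x d) => [->|xd]; first by rewrite (negPf da) (negPf db).
Qed.

Lemma tpermC2 (a b c d : 'I_k) : a != c -> a != d -> b != c -> b != d ->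
  (tperm a b * tperm c d = tperm c d * tperm a b)%g.
Proof.
move=> ac ad bc bd; rewrite conjgC tpermJ.
by rewrite !tpermD // eq_sym.
Qed.

Lemma tperm_braid (a b c : 'I_k) : a != b -> b != c -> a != c ->
  (tperm a b * tperm b c * tperm a b = tperm b c * tperm a b * tperm b c)%g.
Proof.
move=> ab bc ac.
have E (x y z : 'I_k) : x != z -> y != z ->
    (tperm x y * tperm y z * tperm x y = tperm x z)%g.
  move=> xz yz; rewrite -{1}tpermV -mulgA -conjgE tpermJ tpermR tpermD //.
rewrite E // [tperm b c]tpermC [tperm a b]tpermC E 1?tpermC //.
all: by rewrite eq_sym.
Qed.

Lemma QQQ a b c : a != b -> b != c -> a != c ->
  Qm a b * Qm b c * Qm a b = Qm a b.
Proof.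
move=> ab bc ac; have cb : c != b by rewrite eq_sym.
rewrite QmQm3 // -mulrA permQ // tpermL [tperm a c b]tpermD //.
rewrite (QmC bc) mulrA QmQm3 // -mulrA permopM tperm2 permop1.
exact: mulr1.
Qed.

Lemma QQP a b c : a != b -> b != c -> a != c ->
  Qm b c * Qm a b = Qm b c * permop (tperm a c).
Proof.
move=> ab bc ac; rewrite -(QmC ab) -(QmC bc) QmQm3 1?tpermC //.
all: by rewrite eq_sym.
Qed.

Lemma smulM (M N : 'M[K]_D) : (h *: M) * (h *: N) = M * N.
Proof.
by rewrite -!mulmxE -scalemxAl -scalemxAr scalerA h2 scale1r.
Qed.

Lemma sscaleAl c (M N : 'M[K]_D) : (c *: M) * N = c *: (M * N).
Proof. by rewrite -!mulmxE scalemxAl. Qed.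

Lemma sscaleAr c (M N : 'M[K]_D) : M * (c *: N) = c *: (M * N).
Proof. by rewrite -!mulmxE scalemxAr. Qed.

Lemma smulE c (M : 'M[K]_D) : c%:M * M = c *: M.
Proof. exact: mul_scalar_mx. Qed.

Definition lo (i : 'I_k.-1) : 'I_k := widen_ord (leq_pred k) i.

Fact hi_subproof (i : 'I_k.-1) : (i.+1 < k)%N.
Proof. by have := ltn_ord i; case: k i. Qed.

Definition hi (i : 'I_k.-1) : 'I_k := Ordinal (hi_subproof i).

Definition rep_s (i : 'I_k.-1) : 'M[K]_D := h *: opat k i.+1 i.+2 (Pop n).
Definition rep_e (i : 'I_k.-1) : 'M[K]_D := h *: opat k i.+1 i.+2 Qth.

Lemma lohi i : lo i != hi i.
Proof. by rewrite -val_eqE /= neq_ltn ltnSn. Qed.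

Lemma rep_sE i : rep_s i = h *: permop (tperm (lo i) (hi i)).
Proof. by rewrite -opat_Pop ?lohi // -opatE. Qed.

Lemma rep_eE i : rep_e i = h *: Qm (lo i) (hi i).
Proof. by rewrite /Qm -opatE. Qed.

Lemma far_neq i j : far i j -> [/\ lo i != lo j, lo i != hi j,
  hi i != lo j & hi i != hi j].
Proof. by rewrite /far -!val_eqE /=; case/orP => *; split; lia. Qed.

Lemma next_neq (i j : 'I_k.-1) : j = i.+1 :> nat -> [/\ lo j = hi i, lo i != hi j &
  hi i != hi j].
Proof.
by move=> ji; split; [exact: val_inj | rewrite -val_eqE /=; lia..].
Qed.

Fact twisted_rep w : w = h * n%:R ->
  brauer_rep w (@scalar_mx K D : {rmorphism K -> 'M[K]_D}) rep_s rep_e.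
Proof.
move=> ->; split=> [a|a|a|a|a b F|a b F|a b F|a b ab|a b ab|a b ab|a b ab|a b ab];
  rewrite ?rep_sE ?rep_eE ?smulM.
- by rewrite permopM tperm2 permop1.
- rewrite QmQm ?lohi // smulE scalerA mulrAC h2.
  by rewrite mul1r.
- by rewrite PQm ?lohi.
- by rewrite QmP ?lohi.
- by have [*] := far_neq F; rewrite !permopM tpermC2 // eq_sym.
- by have [*] := far_neq F; rewrite QmQmC ?lohi.
- by have [*] := far_neq F; rewrite permQ ?lohi // !tpermD // eq_sym.
- have [-> ac bc] := next_neq ab; rewrite !sscaleAr !permopM.
  by rewrite !mulgA tperm_braid ?lohi.
- have [-> ac bc] := next_neq ab; rewrite sscaleAr QQQ ?lohi //.
- have [-> ac bc] := next_neq ab; rewrite sscaleAr -(QmC bc) -(QmC (lohi a)).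
  by rewrite QQQ // 1?eq_sym ?lohi.
- have [-> ac bc] := next_neq ab.
  rewrite sscaleAr -mulrA QQP ?lohi // mulrA !permQ ?lohi //.
  rewrite tpermR [tperm _ _ (hi b)]tpermD // [tperm _ _ (lo a)]tpermD //;
    try by rewrite eq_sym ?lohi.
  rewrite tpermL -mulrA permopM.
  have -> : (tperm (lo a) (hi b) * tperm (lo a) (hi a) =
             tperm (hi a) (hi b) * tperm (lo a) (hi b))%g.
    rewrite [in RHS]conjgC tpermJ tpermR [tperm _ _ (hi a)]tpermD //.
    by rewrite [tperm (hi a) _]tpermC.
    exact: lohi.
    by rewrite eq_sym.
  rewrite -permopM mulrA QmP // -sscaleAl scalerA h2 scale1r //.
- have [-> ac bc] := next_neq ab.
  rewrite sscaleAr QQP ?lohi // -mulrA permopM.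
  rewrite [tperm (lo a) (hi b)]tpermC.
  have -> : (tperm (hi a) (hi b) * tperm (hi b) (lo a) =
             tperm (lo a) (hi a) * tperm (hi a) (hi b))%g.
    rewrite [in RHS]conjgC tpermJ tpermL [tperm _ _ (lo a)]tpermD //.
    by rewrite [tperm (hi b) _]tpermC.
    by rewrite eq_sym lohi.
    by rewrite eq_sym.
  by rewrite -permopM mulrA QmP // -sscaleAl scalerA h2 scale1r.
Qed.

Lemma sum_mxtens (F : 'I_(n * n) -> K) :
  \sum_p F p = \sum_i \sum_j F (mxtens_index (i, j)).
Proof.
rewrite pair_bigA (reindex (@mxtens_index n n)) /=.
  by apply: eq_bigr => -[i j].
by exists (@mxtens_unindex n n) => p _; rewrite (mxtens_indexK, mxtens_unindexK).
Qed.

Lemma mul_Pop m0 (M : 'M[K]_(n * n, m0)) i j q :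
  (Pop n *m M) (mxtens_index (i, j)) q = M (mxtens_index (j, i)) q.
Proof.
rewrite mxE sum_mxtens (bigD1 j) //= (bigD1 i) //= PopE !eqxx mul1r.
rewrite !big1 ?addr0 // => [l lj|m mi].
  by rewrite big1 // => m _; rewrite PopE [j == l]eq_sym (negPf lj) andbF mul0r.
by rewrite PopE [i == m]eq_sym (negPf mi) mul0r.
Qed.

Lemma mul_Qth m0 (M : 'M[K]_(n * n, m0)) i j q :
  (Qth *m M) (mxtens_index (i, j)) q =
  (j == rev_ord i)%:R * th i *
    \sum_l th l * M (mxtens_index (l, rev_ord l)) q.
Proof.
rewrite mxE sum_mxtens mulr_sumr; apply: eq_bigr => l _.
rewrite (bigD1 (rev_ord l)) //= big1 ?addr0 => [|m ml].
  by rewrite QthE eqxx andbT mulrA [_ * _%:R]mulrC !mulrA.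
by rewrite QthE (negPf ml) andbF mulr0 mul0r.
Qed.

Lemma PopP : Pop n *m Pop n = 1%:M.
Proof.
apply/matrixP => p q; case: (mxtens_indexP p) => i j.
case: (mxtens_indexP q) => l m; rewrite mul_Pop PopE mxE.
by rewrite (inj_eq (can_inj (@mxtens_indexK n n))) xpair_eqE andbC.
Qed.

Lemma Pop_tens (v u : 'cV[K]_n) : Pop n *m (v *t u) = u *t v.
Proof.
apply/matrixP => p q; case: (mxtens_indexP p) => i j.
case: (mxtens_indexP q) => l m; rewrite mul_Pop !tensmxE mulrC.
by rewrite !ord1.
Qed.

Lemma PopQ : Pop n *m Qth = h *: Qth.
Proof.
apply/matrixP => p q; case: (mxtens_indexP p) => i j.
case: (mxtens_indexP q) => l m; rewrite mul_Pop mxE !QthE.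
have -> : (i == rev_ord j) = (j == rev_ord i).
  by apply/eqP/eqP => ->; rewrite rev_ordK.
case: eqP => [->|_]; last by rewrite !mulr0.
by rewrite threv !mulrA.
Qed.

Lemma trQth : Qth^T = Qth.
Proof.
apply/matrixP => p q; case: (mxtens_indexP p) => i j.
case: (mxtens_indexP q) => l m; rewrite mxE !QthE andbC.
by rewrite [th l * _]mulrC.
Qed.

Lemma trPop : (Pop n)^T = Pop n.
Proof.
apply/matrixP => p q; case: (mxtens_indexP p) => i j.
case: (mxtens_indexP q) => l m; rewrite mxE !PopE.
by rewrite [l == j]eq_sym [m == i]eq_sym andbC.
Qed.

Lemma QthP : Qth *m Pop n = h *: Qth.
Proof. by rewrite -[LHS]trmxK trmx_mul trQth trPop PopQ linearZ /= trQth. Qed.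

Lemma QthQ : Qth *m Qth = n%:R *: Qth.
Proof.
apply/matrixP => p q; case: (mxtens_indexP p) => i j.
case: (mxtens_indexP q) => l m; rewrite mul_Qth mxE QthE.
under eq_bigr => x _ do rewrite QthE eqxx andTb !mulrA th2 mul1r.
rewrite sumr_const card_ord -[_ *+ n]mulr_natl mulrCA; congr (_ * _).
by rewrite -mulnb natrM [RHS]mulrACA [th i * _]mulrC.
Qed.

Lemma twisted_idem (c : K) : (2 : K) != 0 -> c * n%:R = h ->
  let B := 2^-1 *: (1%:M - Pop n) + c *: Qth in B *m B = B.
Proof.
move=> two cn /=; set A := 1%:M - Pop n.
have AA : A *m A = 2 *: A.
  by rewrite /A mulmxBl mul1mx mulmxBr mulmx1 PopP scaler_nat mulr2n opprB.
have AQ : A *m Qth = (1 - h) *: Qth.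
  by rewrite mulmxBl mul1mx PopQ scalerBl scale1r.
have QA : Qth *m A = (1 - h) *: Qth.
  by rewrite mulmxBr mulmx1 QthP scalerBl scale1r.
rewrite mulmxDl !mulmxDr -!scalemxAl -!scalemxAr AA AQ QA QthQ !scalerA.
rewrite divfK // -!addrA; congr (_ + _); rewrite -!scalerDl.
congr (_ *: _); rewrite [c / 2]mulrC -[c * c * _]mulrA cn.
rewrite addrA -mulr2n -(mulr_natl (_ * (1 - h))) !mulrA mulfV // mul1r -mulrDr subrK.
exact: mulr1.
Qed.

End Twisted.

Fact Qth1 n : Qth (fun _ : 'I_n => 1) = Qop n.
Proof.
rewrite /Qth /Qop; apply: eq_bigr => i _; apply: eq_bigr => j _.
by rewrite mulr1 scale1r.
Qed.

Fact sgnC2 r (i : 'I_(2 * r)) : sgnC i * sgnC i = 1.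
Proof. by rewrite /sgnC; case: ifP; rewrite ?mulrNN mulr1. Qed.

Fact sgnC_rev r (i : 'I_(2 * r)) : sgnC (rev_ord i) = -1 * sgnC i.
Proof.
rewrite /sgnC /=; have := ltn_ord i.
case: (ltnP i r) => ir iN; case: ltnP => jr; rewrite ?mulrNN ?mulr1 //; lia.
Qed.

Lemma Bop_idem n : (2 : K) != 0 -> (n%:R : K) != 0 -> Bop n *m Bop n = Bop n.
Proof.
move=> two n0; rewrite /Bop -Qth1; apply: (@twisted_idem n 1) => //.
- by move=> i; rewrite mulr1.
- by move=> i; rewrite mulr1.
- exact: mulVf.
Qed.

Lemma Btop_idem r : (2 : K) != 0 -> ((2 * r)%:R : K) != 0 ->
  Btop r *m Btop r = Btop r.
Proof.
move=> two n0; rewrite /Btop -scaleNr; apply: (@twisted_idem _ (-1) (@sgnC r)) => //.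
- exact: sgnC2.
- exact: sgnC_rev.
- by rewrite mulNr mulVf.
Qed.

Section Representations.
Variable k : nat.

Section Orthogonal.
Variable n : nat.
Local Notation D := (tdim k n).
Local Notation scal := (@scalar_mx K D : {rmorphism K -> 'M[K]_D}).

Definition rho_s (i : 'I_k.-1) : 'M[K]_D := opat k i.+1 i.+2 (Pop n).
Definition rho_e (i : 'I_k.-1) : 'M[K]_D := opat k i.+1 i.+2 (Qop n).

Fact rho_rep : brauer_rep n%:R scal rho_s rho_e.
Proof.
have -> : rho_s = @rep_s k n 1 by apply/funext => i; rewrite /rep_s scale1r.
have -> : rho_e = @rep_e k n 1 (fun=> 1).
  by apply/funext => i; rewrite /rep_e scale1r Qth1.
by apply: twisted_rep; rewrite ?mul1r // => i; rewrite mul1r.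
Qed.

Fact rho_compatible :
  compatible (brauer_presentation k n%:R) scal (rep_gen rho_s rho_e).
Proof. by apply: brauer_compatible rho_rep => c M; exact: comm_scalar_mx. Qed.

Definition rho : brauer k (n%:R : K) -> 'M[K]_D := plift rho_compatible.

HB.instance Definition _ := GRing.isZmodMorphism.Build _ _ rho
  (plift_is_zmod_morphism rho_compatible).
HB.instance Definition _ := GRing.isMonoidMorphism.Build _ _ rho
  (plift_is_monoid_morphism rho_compatible).

Fact rho_is_scalable : scalable rho.
Proof. by move=> c u; rewrite /rho pliftZ; exact: mul_scalar_mx. Qed.

HB.instance Definition _ := GRing.isScalable.Build K _ _ _ rho rho_is_scalable.

Lemma rho_sigma a : (0 < a < k)%N -> rho (bsigma k n%:R a) = opat k a a.+1 (Pop n).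
Proof.
case: a => //= a ak; have ak' : (a < k.-1)%N by rewrite -ltnS (ltn_predK ak).
by rewrite (bsigma_ord _ (Ordinal ak')) /rho plift_gen.
Qed.

Lemma rho_eps a : (0 < a < k)%N -> rho (beps k n%:R a) = opat k a a.+1 (Qop n).
Proof.
case: a => //= a ak; have ak' : (a < k.-1)%N by rewrite -ltnS (ltn_predK ak).
by rewrite (beps_ord _ (Ordinal ak')) /rho plift_gen.
Qed.

Definition Yop (b : nat) : 'M[K]_D :=
  \sum_(1 <= a < b) (opat k a b (Pop n) - opat k a b (Qop n)).

End Orthogonal.

Section Symplectic.
Variable r : nat.
Local Notation D := (tdim k (2 * r)).
Local Notation scal := (@scalar_mx K D : {rmorphism K -> 'M[K]_D}).

Definition rhot_s (i : 'I_k.-1) : 'M[K]_D := - opat k i.+1 i.+2 (Pop (2 * r)).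
Definition rhot_e (i : 'I_k.-1) : 'M[K]_D := - opat k i.+1 i.+2 (Qtop r).

Fact rhot_rep : brauer_rep (- (2 * r)%:R) scal rhot_s rhot_e.
Proof.
have -> : rhot_s = @rep_s k (2 * r) (-1) by apply/funext => i; rewrite /rep_s scaleN1r.
have -> : rhot_e = @rep_e k (2 * r) (-1) (@sgnC r).
  by apply/funext => i; rewrite /rep_e scaleN1r.
apply: twisted_rep; rewrite ?mulrNN ?mulN1r ?mulr1 //; first exact: sgnC2.
exact: sgnC_rev.
Qed.

Fact rhot_compatible : compatible (brauer_presentation k (- (2 * r)%:R)) scal
  (rep_gen rhot_s rhot_e).
Proof. by apply: brauer_compatible rhot_rep => c M; exact: comm_scalar_mx. Qed.

Definition rhot : brauer k (- (2 * r)%:R : K) -> 'M[K]_D := plift rhot_compatible.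

HB.instance Definition _ := GRing.isZmodMorphism.Build _ _ rhot
  (plift_is_zmod_morphism rhot_compatible).
HB.instance Definition _ := GRing.isMonoidMorphism.Build _ _ rhot
  (plift_is_monoid_morphism rhot_compatible).

Fact rhot_is_scalable : scalable rhot.
Proof. by move=> c u; rewrite /rhot pliftZ; exact: mul_scalar_mx. Qed.

HB.instance Definition _ := GRing.isScalable.Build K _ _ _ rhot rhot_is_scalable.

Lemma rhot_sigma a : (0 < a < k)%N ->
  rhot (bsigma k (- (2 * r)%:R) a) = - opat k a a.+1 (Pop (2 * r)).
Proof.
case: a => //= a ak; have ak' : (a < k.-1)%N by rewrite -ltnS (ltn_predK ak).
by rewrite (bsigma_ord _ (Ordinal ak')) /rhot plift_gen.
Qed.

Lemma rhot_eps a : (0 < a < k)%N ->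
  rhot (beps k (- (2 * r)%:R) a) = - opat k a a.+1 (Qtop r).
Proof.
case: a => //= a ak; have ak' : (a < k.-1)%N by rewrite -ltnS (ltn_predK ak).
by rewrite (beps_ord _ (Ordinal ak')) /rhot plift_gen.
Qed.

Definition Ytop (b : nat) : 'M[K]_D :=
  - \sum_(1 <= a < b) (opat k a b (Pop (2 * r)) - opat k a b (Qtop r)).

End Symplectic.
End Representations.

Section QuadraticAlgebras.
Variables (n : nat) (A : 'M[K]_(n * n)).
Local Notation F := {malg K[{fmonom 'I_n}]}.
Local Notation x i := (fgen K (i : 'I_n)).

(* A (e_i \otimes e_j) = \sum_(k, l) mxent k l i j e_k \otimes e_l *)
Definition mxent (k l i j : 'I_n) : K :=
  A (mxtens_index (k, l)) (mxtens_index (i, j)).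

Variant X_rel : F -> F -> Prop :=
  X_Rel k l : X_rel (\sum_i \sum_j mxent k l i j *: (x i * x j)) 0.

Variant Xd_rel : F -> F -> Prop :=
  Xd_Rel k l : Xd_rel (\sum_i \sum_j mxent i j k l *: (x i * x j)) 0.

Variant Xi_rel : F -> F -> Prop :=
  Xi_Rel i j : Xi_rel (x i * x j) (\sum_k \sum_l mxent k l i j *: (x k * x l)).

Variant Xid_rel : F -> F -> Prop :=
  Xid_Rel i j : Xid_rel (x i * x j) (\sum_k \sum_l mxent i j k l *: (x k * x l)).

Local Notation ev0 := (feval (idfun : {rmorphism K -> K}) (fun _ : 'I_n => 0)).

Fact ev0M i j : ev0 (x i * x j) = 0.
Proof.
rewrite fevalM => [|c t]; last exact: mulrC.
by rewrite feval_gen mul0r.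
Qed.

Fact ev0_quadratic (c : 'I_n -> 'I_n -> K) :
  ev0 (\sum_i \sum_j c i j *: (x i * x j)) = 0.
Proof.
rewrite raddf_sum big1 //= => i _; rewrite raddf_sum big1 //= => j _.
rewrite fevalZ => [|d t]; last exact: mulrC.
by rewrite ev0M mulr0.
Qed.

Fact X_charP u v : X_rel u v -> ev0 u = ev0 v.
Proof. by case=> k l; rewrite ev0_quadratic raddf0. Qed.

Fact Xd_charP u v : Xd_rel u v -> ev0 u = ev0 v.
Proof. by case=> k l; rewrite (ev0_quadratic (fun i j => mxent i j k l)) raddf0. Qed.

Fact Xi_charP u v : Xi_rel u v -> ev0 u = ev0 v.
Proof. by case=> i j; rewrite ev0M (ev0_quadratic (fun k l => mxent k l i j)). Qed.

Fact Xid_charP u v : Xid_rel u v -> ev0 u = ev0 v.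
Proof. by case=> i j; rewrite ev0M ev0_quadratic. Qed.

Definition X_pres := Presentation X_charP.
Definition Xd_pres := Presentation Xd_charP.
Definition Xi_pres := Presentation Xi_charP.
Definition Xid_pres := Presentation Xid_charP.

End QuadraticAlgebras.

Section SAOperators.
Variables k n : nat.
Local Notation D := (tdim k n).

Definition tens_col (B : algType K) (x : 'I_n -> B) : 'cV[B]_D :=
  \col_p \prod_(a < k) x ((enum_val p : multi k n) a).
Definition tens_row (B : algType K) (x : 'I_n -> B) : 'rV[B]_D :=
  \row_p \prod_(a < k) x ((enum_val p : multi k n) a).

Definition lift_op (B : algType K) (S : 'M[K]_D) : 'M[B]_D :=
  map_mx (in_alg B) S.

Definition is_S_operator (A : 'M[K]_(n * n)) (S : 'M[K]_D) : Prop :=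
  [/\ forall a, (1 <= a < k)%N ->
        opat k a a.+1 A *m S = 0 /\ S *m opat k a a.+1 A = 0,
      let Xk := tens_row (pgen (Xd_pres A)) in
        Xk *m lift_op _ S = Xk
    & let Xk := tens_col (pgen (X_pres A)) in
        lift_op _ S *m Xk = Xk].

Definition is_A_operator (A : 'M[K]_(n * n)) (Ak : 'M[K]_D) : Prop :=
  [/\ forall a, (1 <= a < k)%N ->
        opat k a a.+1 (1%:M - A) *m Ak = 0 /\ Ak *m opat k a a.+1 (1%:M - A) = 0,
      let Psik := tens_row (pgen (Xi_pres A)) in
        Psik *m lift_op _ Ak = Psik
    & let Psik := tens_col (pgen (Xid_pres A)) in
        lift_op _ Ak *m Psik = Psik].

End SAOperators.
End TensorSpace.

Arguments Pop {K} n.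
Arguments Qop {K} n.
Arguments Qtop {K} r.
Arguments Bop {K} n.
Arguments Btop {K} r.
Arguments Yop {K} k n b.
Arguments Ytop {K} k r b.

(* Main.v *)
Require Import Defs.
From HB Require Import structures.
From mathcomp Require Import all_boot all_order all_algebra.
From mathcomp Require Import fingroup perm.
From mathcomp Require Import boolp reals complex zify ring finmap monalg mxtens.

(* Let q be the symmetrizer on k - 1 strands, on which the subalgebra they generate
   acts through the augmentation.  It commutes with y_k, which commutes with
   that subalgebra.  Since epsilon_(k-1) (y_(k-1) + y_k) = (1 - w) epsilon_(k-1)
   and y_(k-1) q = (k - 2) q, the element g = (y_k + w + k - 3) q is killed by
   epsilon_(k-1).  Hence epsilon_(a k) g = 0 for all a, and (y_k + 1) g is the sum of
   the sigma_a ... sigma_(k-1) g over 1 <= a <= k, that is, over coset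
   representatives of S_k modulo S_(k-1), acting on the S_(k-1)-invariant g;
   so it is S_k-invariant.  Invariance on the right is the same statement in
   the converse ring.
   In the tensor representations, the quadratic relations say that sigma_a fixes
   and epsilon_a kills the k-fold products of generators, so the whole Brauer
   algebra acts on them through its augmentation, and s_(k) fixes them. *)

Set Implicit Arguments.
Unset Strict Implicit.
Unset Printing Implicit Defensive.

Import Order.TTheory GRing.Theory Num.Theory.

Local Open Scope ring_scope.

(** * The symmetrizer in an abstract ring *)

(* The relations are closed under reversal of products, so that a family in A
   is also one in the converse ring A^c. *)
Record brauer_family (A : pzRingType) (w : A) (k : nat) (S E : nat -> A) :
    Prop := BrauerFamily {
  fam_w x : GRing.comm w x;
  fam_ss a : (0 < a < k)%N -> S a * S a = 1;
  fam_ee a : (0 < a < k)%N -> E a * E a = w * E a;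
  fam_se a : (0 < a < k)%N -> S a * E a = E a;
  fam_es a : (0 < a < k)%N -> E a * S a = E a;
  fam_far a b : (0 < a)%N -> (a.+1 < b < k)%N ->
    [/\ GRing.comm (S a) (S b), GRing.comm (E a) (E b),
        GRing.comm (S a) (E b) & GRing.comm (E a) (S b)];
  fam_sss a : (0 < a)%N -> (a.+1 < k)%N ->
    S a * S a.+1 * S a = S a.+1 * S a * S a.+1;
  fam_see a : (0 < a)%N -> (a.+1 < k)%N ->
    S a * E a.+1 * E a = S a.+1 * E a /\ S a.+1 * E a * E a.+1 = S a * E a.+1;
  fam_ees a : (0 < a)%N -> (a.+1 < k)%N ->
    E a.+1 * E a * S a.+1 = E a.+1 * S a /\ E a * E a.+1 * S a = E a * S a.+1
}.

Lemma brauer_family_conv (A : pzRingType) (w : A) k S E :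
  brauer_family w k S E -> @brauer_family A^c w k S E.
Proof.
case=> w_ ss ee se es far sss see ees.
have wC x : x * w = w * x by exact: (esym (w_ x)).
split.
- by move=> x; exact: (esym (w_ x)).
- exact: ss.
- by move=> a ak; rewrite -[RHS](w_ (E a)); exact: ee.
- exact: es.
- exact: se.
- move=> a b a0 ab; have [f1 f2 f3 f4] := far a b a0 ab.
  by split; [exact: (esym f1)|exact: (esym f2)|exact: (esym f3)|exact: (esym f4)].
- by move=> a a0 ak; have h := sss a a0 ak; rewrite -!mulrA in h; exact: h.
- move=> a a0 ak; have [h1 h2] := ees a a0 ak; rewrite -!mulrA in h1 h2.
  by split; [exact: h2 | exact: h1].
- move=> a a0 ak; have [h1 h2] := see a a0 ak; rewrite -!mulrA in h1 h2.
  by split; [exact: h2 | exact: h1].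
Qed.

Lemma conj_sumr (A : pzRingType) (I : Type) (r : seq I) (s : A) (F : I -> A) :
  s * (\sum_(i <- r) F i) * s = \sum_(i <- r) s * F i * s.
Proof. by rewrite mulr_sumr mulr_suml. Qed.

(* [jucys n] is the Jucys-Murphy element y_(n+1). *)
Fixpoint jucys (A : pzRingType) (S E : nat -> A) (n : nat) : A :=
  if n is m.+1 then S n * jucys S E m * S n + S n - E n else 0.

Lemma jucys_conv (A : pzRingType) (S E : nat -> A) n :
  @jucys A^c S E n = jucys S E n.
Proof.
elim: n => //= n ->.
exact: (congr1 (fun x => x + S n.+1 - E n.+1)
  (mulrA (S n.+1) (jucys S E n) (S n.+1))).
Qed.

(* The sum of the elements [S a * S a.+1 * ... * S n] for [1 <= a <= n]. *)
Fixpoint coset_sum (A : pzRingType) (S : nat -> A) (n : nat) : A :=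
  if n is m.+1 then (1 + coset_sum S m) * S n else 0.

(** The symmetrizer on n + 1 strands without its scalar denominators, which an arbitrary ring may
    not have; the factor [i] belongs to b = i + 2. *)
Definition sym_prod (A : pzRingType) (w : A) (S E : nat -> A) (n : nat) : A :=
  \prod_(i < n)
    ((jucys S E i.+1 + 1) * (jucys S E i.+1 + (w + i.+2%:R - 3))).

(** * Invariance of the symmetrizer under left multiplication *)

Section LeftInvariance.
Variables (A : pzRingType) (w : A) (k : nat) (S E : nat -> A).
Hypothesis fam : brauer_family w k S E.
Local Notation J := (jucys S E).
Local Notation U := (coset_sum S).
Local Notation Q := (sym_prod w S E).
Local Notation comm := GRing.comm.

Lemma comm_jucys_far n a : (n.+1 < a < k)%N -> comm (S a) (J n) /\ comm (E a) (J n).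
Proof.
elim: n => [|n IH] na; first by split; exact: commr0.
have [|c1 c2] := IH; first lia.
have [||f1 f2 f3 f4] := fam_far fam (a := n.+1) (b := a); [lia..|].
by split; (apply: commrB; [apply: commrD; [apply: commrM; [apply: commrM|]|]|]) => //;
  exact/commr_sym.
Qed.

Lemma comm_coset_sum n a : (n.+1 < a < k)%N -> comm (S a) (U n).
Proof.
elim: n => [|n IH] na; first exact: commr0.
have [||f1 _ _ _] := fam_far fam (a := n.+1) (b := a); [lia..|].
apply: commrM; last exact/commr_sym.
by apply: commrD; [exact: commr1 | apply: IH; lia].
Qed.

(** Conjugation by the involution [s] exchanges the two summands. *)
Lemma comm_conj_add (s z : A) : s * s = 1 -> comm s (s * z * s + z).
Proof.
move=> ss; rewrite /GRing.comm mulrDr mulrDl !mulrA ss mul1r.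
by rewrite -[s * z * s * s]mulrA ss mulr1 addrC.
Qed.

(** Only a = n - 1 is new: a smaller index is far from the outer generators of [J n] and commutes
    with [J n.-1] by induction. For a = n - 1 the recursion is unfolded twice. *)
Lemma comm_jucys n a : (0 < a < n)%N -> (n < k)%N ->
  comm (S a) (J n) /\ comm (E a) (J n).
Proof.
elim: n => [|n IH] an nk; first lia.
have [{}an|{}an] : (0 < a < n)%N \/ a = n /\ (0 < n)%N by lia.
  have [|c1 c2] := IH an; first lia.
  have [||f1 f2 f3 f4] := fam_far fam (a := a) (b := n.+1); [lia..|].
  by split; apply: commrB => //; apply: commrD => //; apply: commrM => //;
    apply: commrM.
case: an nk => -> {a IH}; case: n => // n _ nk /=.
have nk' : (0 < n.+1 < k)%N by lia.
have nk2 : (0 < n.+2 < k)%N by lia.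
have [yS yE] : comm (S n.+2) (J n) /\ comm (E n.+2) (J n).
  by apply: comm_jucys_far; lia.
have sss := fam_sss fam (a := n.+1) isT nk.
have [see1 see2] := fam_see fam (a := n.+1) isT nk.
have [ees1 ees2] := fam_ees fam (a := n.+1) isT nk.
have s1s1 := fam_ss fam nk'; have s2s2 := fam_ss fam nk2.
have se1 := fam_se fam nk'; have es1 := fam_es fam nk'.
move: (J n) (S n.+1) (S n.+2) (E n.+1) (E n.+2) => y s1 s2 e1 e2
  in yS yE sss see1 see2 ees1 ees2 s1s1 s2s2 se1 es1 *.
(* By [s2 * s1 * s2 = s1 * s2 * s1] and [s2 * e1 * s2 = s1 * e2 * s1] the short terms pair up as in
   [comm_conj_add]. *)
have -> : s2 * (s1 * y * s1 + s1 - e1) * s2 + s2 - e2 =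
    s2 * s1 * y * s1 * s2 + ((s1 * s2 * s1 + s2) - (s1 * e2 * s1 + e2)).
  rewrite !(mulrDr, mulrDl, mulrN, mulNr) !mulrA -sss -see1.
  rewrite -[s1 * e2 * e1 * s2]mulrA -[s1 * e2 * (e1 * s2)]mulrA.
  rewrite [e2 * (_ * _)]mulrA ees1 mulrA.
  by rewrite opprD !addrA [X in _ = X - _]addrAC.
split.
  apply: commrD; last by apply: commrB; exact: comm_conj_add.
  rewrite /GRing.comm !mulrA sss -[s2 * s1 * s2 * y]mulrA yS.
  by rewrite -!mulrA [s2 * (s1 * s2)]mulrA -sss !mulrA.
have e1s2s1 : e1 * s2 * s1 = e1 * e2 by rewrite -ees2 -mulrA s1s1 mulr1.
have s1s2e1 : s1 * s2 * e1 = e2 * e1 by rewrite -mulrA -see1 !mulrA s1s1 mul1r.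
(* [e1] kills the bracket from either side: [e1 * (s1 * s2 * s1 + s2)] and
   [e1 * (s1 * e2 * s1 + e2)] are both [e1 * e2 + e1 * s2]. *)
apply: commrD; last first.
  rewrite /GRing.comm !(mulrDr, mulrDl, mulrN, mulNr) !mulrA es1.
  rewrite -![_ * s1 * e1]mulrA se1 e1s2s1 s1s2e1 ees2 see1.
  by rewrite [e1 * e2 + _]addrC [e2 * e1 + _]addrC !subrr.
(* Multiplied by [e1] on either side, the long term reduces to [e1 * y * e2 * e1]. *)
rewrite /GRing.comm -!mulrA [s1 * (s2 * e1)]mulrA s1s2e1.
have -> : e1 * (s2 * (s1 * (y * (s1 * s2)))) = e1 * y * (e2 * s1 * s2).
  by rewrite !mulrA e1s2s1 -[e1 * e2 * y]mulrA yE !mulrA.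
have -> : s2 * (s1 * (y * (e2 * e1))) = s2 * s1 * e2 * y * e1.
  by rewrite [y * _]mulrA -yE !mulrA.
rewrite -ees1 -[e2 * e1 * s2 * s2]mulrA s2s2 mulr1.
rewrite -[s2 * s1 * e2]mulrA -see2 !mulrA s2s2 mul1r.
by rewrite -[e1 * e2 * y]mulrA yE !mulrA.
Qed.

(** For m < n, every generator occurring in [J m] commutes with [J n]. *)
Lemma jucys_comm m n : (m <= n)%N -> (n < k)%N -> comm (J m) (J n).
Proof.
elim: m => [|m IH] mn nk; first exact/commr_sym/commr0.
have [->|{}mn] : m.+1 = n \/ (m.+1 < n)%N by lia.
  by [].
have [|/commr_sym c1 /commr_sym c2] := @comm_jucys n m.+1 _ nk; first lia.
apply: commr_sym; apply: commrB => //; apply: commrD => //.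
by apply: commrM => //; apply: commrM => //; apply/commr_sym/IH; lia.
Qed.

(** Right multiplication by the transposition of strands n + 1 and n + 2 exchanges [E n.+1] times
    sigma_(a,n+1) with [E n.+1] times epsilon_(a,n+1), and these enter through [J n] with opposite
    signs. *)
Lemma E_jucys_anti n : (n.+1 < k)%N -> E n.+1 * J n * S n.+1 = - (E n.+1 * J n).
Proof.
elim: n => [|n IH] nk; first by rewrite !mulr0 mul0r oppr0.
have nk2 : (0 < n.+2 < k)%N by lia.
have [yS yE] : comm (S n.+2) (J n) /\ comm (E n.+2) (J n).
  by apply: comm_jucys_far; lia.
have {IH} := IH (ltnW nk).
have sss := fam_sss fam (a := n.+1) isT nk.
have [ees1 _] := fam_ees fam (a := n.+1) isT nk.
have s2s2 := fam_ss fam nk2.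
rewrite /=.
move: (J n) (S n.+1) (S n.+2) (E n.+1) (E n.+2) => y s1 s2 e1 e2
  in yS yE sss ees1 s2s2 *.
move=> IH; rewrite !(mulrDr, mulrDl, mulrN, mulNr) !mulrA.
have e2s1s2 : e2 * s1 * s2 = e2 * e1 by rewrite -ees1 -mulrA s2s2 mulr1.
rewrite e2s1s2 ees1 !opprD opprK [RHS]addrAC; congr (_ + _ - _).
(* Writing [e2 * s1] as [e2 * e1 * s2] lets [s2] pass [y]; the braid relation then exposes
   [e1 * y * s1] for the induction hypothesis. *)
rewrite -ees1 -[e2 * e1 * s2 * y]mulrA yS mulrA.
have -> : e2 * e1 * y * s2 * s1 * s2 = e2 * (e1 * y * s1) * s2 * s1.
  by rewrite -!mulrA [s2 * (s1 * _)]mulrA -sss !mulrA.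
by rewrite IH mulrN !mulNr !mulrA.
Qed.

(** After [E n.+1 * S n.+1 = E n.+1], the conjugated term of [J n.+1] is the one in
    [E_jucys_anti]. *)
Lemma E_jucysD n : (n.+1 < k)%N -> E n.+1 * J n.+1 = (1 - w) * E n.+1 - E n.+1 * J n.
Proof.
move=> nk; have nk' : (0 < n.+1 < k)%N by lia.
rewrite /= !(mulrDr, mulrN, mulrDl, mulNr) !mulrA (fam_es fam) // (fam_ee fam) //.
by rewrite E_jucys_anti // mul1r -addrA addrC.
Qed.

(** In S_(n+1) S_a ... S_n S_(n+1) g the outer factor moves up to S_n, and the braid relation turns
    it into an S_n that [g] absorbs. *)
Lemma coset_sum_inv n g : (n.+1 < k)%N ->
  (forall a, (0 < a <= n)%N -> S a * g = g) ->
  S n.+1 * (U n * (S n.+1 * g)) = U n * (S n.+1 * g).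
Proof.
case: n => [|n] nk Sg; first by rewrite !(mul0r, mulr0).
have SU : S n.+2 * (1 + U n) = (1 + U n) * S n.+2.
  by apply: commrD; [exact: commr1 | apply: comm_coset_sum; lia].
rewrite /= !mulrA SU -!mulrA; congr (_ * _); rewrite !mulrA.
by rewrite -(fam_sss fam) // -[LHS]mulrA Sg //; lia.
Qed.

(** The transposition (a, n + 2) is the coset representative S_a ... S_(n+1) times a permutation of
    the first n + 1 strands, which fixes [g]; the terms epsilon_(a,n+2) vanish on [g]. *)
Lemma jucys_coset n g : (n.+1 < k)%N ->
  (forall a, (0 < a <= n)%N -> S a * g = g) -> E n.+1 * g = 0 ->
  J n.+1 * g = U n.+1 * g.
Proof.
elim: n g => [|n IH] g nk Sg Eg.
  by rewrite /= !(mulr0, mul0r, add0r, addr0, mul1r) mulrBl Eg subr0.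
(* The induction hypothesis is applied to [S n.+2 * g], which [E n.+1] kills since [E n.+1 * S n.+2
   = E n.+1 * E n.+2 * S n.+1]. *)
rewrite [J _]/= mulrBl Eg subr0 mulrDl -2!mulrA IH; first last.
- have [_ h] := fam_ees fam (a := n.+1) isT nk.
  by rewrite mulrA -h -mulrA Sg ?leqnn // -mulrA Eg mulr0.
- move=> a an; have [||SS _ _ _] := fam_far fam (a := a) (b := n.+2); [lia..|].
  by rewrite mulrA SS -mulrA Sg //; lia.
- lia.
by rewrite coset_sum_inv // [U n.+2]/= -mulrA mulrDl mul1r addrC.
Qed.

(** [(J n.+1 + 1) * g] is [g + S n.+1 * g + U n * (S n.+1 * g)]; multiplication by [S n.+1]
    exchanges the first two terms and fixes the third. *)
Lemma jucys_inv n g : (n.+1 < k)%N ->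
  (forall a, (0 < a <= n)%N -> S a * g = g) -> E n.+1 * g = 0 ->
  S n.+1 * ((J n.+1 + 1) * g) = (J n.+1 + 1) * g.
Proof.
move=> nk Sg Eg; rewrite mulrDl jucys_coset // /= -mulrA mulrDl !mul1r.
rewrite !mulrDr coset_sum_inv // !mulrA (fam_ss fam) ?mul1r //.
by rewrite [LHS]addrC [g + _]addrC addrA.
Qed.

Lemma sym_prodS n : Q n.+1 =
  Q n * ((J n.+1 + 1) * (J n.+1 + (w + n.+2%:R - 3))).
Proof. by rewrite /sym_prod big_ord_recr. Qed.

Lemma comm_scalar (c : A) n : comm (w + n%:R - 3) c.
Proof.
apply: commr_sym; apply: commrB; last exact: commr_nat.
by apply: commrD; [exact: commr_sym (fam_w fam _) | exact: commr_nat].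
Qed.

Lemma comm_sym_prod x n :
  (forall i, (i < n)%N -> comm x (J i.+1)) -> comm x (Q n).
Proof.
move=> xJ; apply: commr_prod => i _; have cx := xJ i (ltn_ord i).
apply: commrM; first by apply: commrD; [|exact: commr1].
by apply: commrD => //; exact/commr_sym/comm_scalar.
Qed.

Lemma jucys_trivial m g : (forall a, (0 < a <= m)%N -> S a * g = g /\ E a * g = 0) ->
  J m * g = m%:R * g.
Proof.
elim: m => [|m IH] tr; first by rewrite !mul0r.
have [|Sg Eg] := tr m.+1; first by rewrite leqnn.
rewrite /= mulrBl mulrDl -!mulrA Sg Eg subr0 IH => [|a am]; last by apply: tr; lia.
by rewrite mulrA (commr_nat (S _)) -mulrA Sg -natr1 mulrDl mul1r.
Qed.

(** Induction over the strands: generators of index at most n pass through the new factors to [Q n],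
    so only the index n + 1 is new. *)
Lemma sym_prod_trivial n a : (n < k)%N -> (0 < a <= n)%N ->
  S a * Q n = Q n /\ E a * Q n = 0.
Proof.
elim: n a => [|n IH] a nk an; first lia.
set c := w + n.+2%:R - 3.
have cC x : comm c x by exact: comm_scalar.
have QJ : comm (J n.+1) (Q n).
  by apply: comm_sym_prod => i ni; apply/commr_sym/jucys_comm; lia.
have JcC : comm (J n.+1 + 1) (J n.+1 + c).
  by apply: commrD; apply/commr_sym; [apply: commrD | exact: cC] => //; exact: commr1.
have QF : comm (Q n) ((J n.+1 + 1) * (J n.+1 + c)).
  apply: commrM; apply: commrD; apply: commr_sym => //; exact/commr_sym/commr1.
have QnS : Q n.+1 = (J n.+1 + 1) * ((J n.+1 + c) * Q n).
  by rewrite sym_prodS -/c QF mulrA.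
have triv b : (0 < b <= n)%N -> S b * ((J n.+1 + c) * Q n) = (J n.+1 + c) * Q n
    /\ E b * ((J n.+1 + c) * Q n) = 0.
  move=> bn; have [|SQ EQ] := IH b _ bn; first lia.
  have [|SJ EJ] := @comm_jucys n.+1 b _ nk; first lia.
  have comm_Jc x : comm x (J n.+1) -> comm x (J n.+1 + c).
    by move=> xJ; apply: commrD => //; exact/commr_sym.
  by rewrite !mulrA (comm_Jc _ SJ) (comm_Jc _ EJ) -!mulrA SQ EQ mulr0.
have Etop : E n.+1 * ((J n.+1 + c) * Q n) = 0.
  rewrite mulrA mulrDr E_jucysD // -cC mulrBl mulrDl mulrBl.
  rewrite -2!mulrA (jucys_trivial (m := n)) => [|b bn]; last by apply: IH; lia.
  rewrite [E _ * (_ * _)]mulrA (commr_nat (E _)) -[_ * E _ * Q n]mulrA -!mulrBl.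
  rewrite -[(_ - _) * _ * _]mulrA -mulrBl -mulrDl.
  (* On [Q n], [E n.+1 * J n.+1] acts as 1 - w - n times [E n.+1]; the shift c = w + (n + 2) - 3 is
     chosen to cancel this. *)
  have -> : 1 - w - n%:R + c = 0; last by rewrite mul0r.
  rewrite /c -addn2 natrD [w + _]addrC [_ - 3]addrAC.
  have -> : n%:R + 2 - 3 = n%:R - 1 :> A.
    by rewrite -[3%:R in LHS]natr1 opprD addrA addrK.
  rewrite -[_ - 1 + w]addrA [LHS]addrA.
  by rewrite subrK [-1 + w]addrC addrA subrK subrr.
case: (ltngtP a n.+1) => an'.
- have [|SQ EQ] := triv a; first lia.
  have [|SJ EJ] := @comm_jucys n.+1 a _ nk; first lia.
  have comm_J1 x : comm x (J n.+1) -> comm x (J n.+1 + 1).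
    by move=> xJ; apply: commrD => //; exact: commr1.
  rewrite QnS (mulrA (S a)) (mulrA (E a)) (comm_J1 _ SJ) (comm_J1 _ EJ).
  by rewrite -!(mulrA (_ + 1)) SQ EQ mulr0.
- lia.
rewrite an' QnS; split.
  by apply: jucys_inv => // b bn; have [] := triv b bn.
(* All factors commute, so [J n.+1 + 1] moves to the far right and [Etop] applies. *)
have -> : (J n.+1 + 1) * ((J n.+1 + c) * Q n) = (J n.+1 + c) * Q n * (J n.+1 + 1).
  rewrite mulrA JcC -!mulrA; congr (_ * _).
  by apply: commr_sym; apply: commrD; [exact: commr_sym | exact: commr1].
by rewrite mulrA Etop mul0r.
Qed.
End LeftInvariance.

(** The factors are polynomials with central coefficients in commuting elements, so the reversed
    product has the same value. *)
Lemma sym_prod_conv (A : pzRingType) (w : A) k (S E : nat -> A) n :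
  brauer_family w k S E -> (n < k)%N ->
  @sym_prod A^c w S E n = sym_prod w S E n.
Proof.
move=> fam; elim: n => [|n IH] nk; first by rewrite /sym_prod !big_ord0.
rewrite !sym_prodS IH ?jucys_conv; last lia.
set J := jucys S E n.+1; set c := w + _ - 3; set q := sym_prod w S E n.
have cC x : GRing.comm c x by exact: (comm_scalar fam).
have QJ : GRing.comm q J.
  apply: commr_sym; apply: (comm_sym_prod fam) => i ni.
  by apply: commr_sym; apply: (jucys_comm fam); lia.
(* The multiplication of [A^c] spelled out as reversed products in [A]. *)
change ((J + c) * (J + 1) * q = q * ((J + 1) * (J + c))).
have -> : (J + c) * (J + 1) = (J + 1) * (J + c).
  by apply: commrD; [apply/commr_sym/commrD => //; exact/commr_sym | exact: commr1].
apply: commr_sym; apply: commrM; apply: commrD => //; first exact: commr1.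
exact/commr_sym.
Qed.

Lemma sym_prod_trivialr (A : pzRingType) (w : A) k (S E : nat -> A) n a :
  brauer_family w k S E -> (n < k)%N -> (0 < a <= n)%N ->
  sym_prod w S E n * S a = sym_prod w S E n /\ sym_prod w S E n * E a = 0.
Proof.
move=> fam nk an; have famc := brauer_family_conv fam.
have := sym_prod_trivial famc nk an; rewrite (sym_prod_conv fam nk) => h; exact: h.
Qed.

(** * The symmetrizer of the Brauer algebra *)

Section BrauerSymmetrizer.
Variables (K : fieldType) (k : nat) (w : K).
Local Notation S := (bsigma k w).
Local Notation E := (beps k w).

Lemma brauer_ordP a : (0 < a < k)%N -> exists i : 'I_k.-1, a = i.+1.
Proof.
case: a => // a ak; have ak' : (a < k.-1)%N by lia.
by exists (Ordinal ak').
Qed.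

Fact brauer_is_family : brauer_family (w%:A : brauer k w) k S E.
Proof.
pose P := @brauer_presentation K k w.
pose T := ('I_k.-1 + 'I_k.-1)%type.
have g2 (i j : T) : ppi P (fgen K i * fgen K j) = pgen P i * pgen P j.
  exact: rmorphM.
have g3 (i j l : T) :
    ppi P (fgen K i * fgen K j * fgen K l) = pgen P i * pgen P j * pgen P l.
  by rewrite -g2; exact: rmorphM.
(* The digits in [r21] to [r33] are the numbers of letters on the two sides of a relation. *)
have r21 (i j l : T) : brauer_rel w (fgen K i * fgen K j) (fgen K l) ->
    pgen P i * pgen P j = pgen P l.
  by move/(@ppi_rel _ _ P); exact: etrans (esym (g2 _ _)).
have r22 (i j l m : T) :
    brauer_rel w (fgen K i * fgen K j) (fgen K l * fgen K m) ->
    pgen P i * pgen P j = pgen P l * pgen P m.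
  move/(@ppi_rel _ _ P) => h.
  exact: etrans (esym (g2 _ _)) (etrans h (g2 _ _)).
have r31 (i j l m : T) :
    brauer_rel w (fgen K i * fgen K j * fgen K l) (fgen K m) ->
    pgen P i * pgen P j * pgen P l = pgen P m.
  by move/(@ppi_rel _ _ P); exact: etrans (esym (g3 _ _ _)).
have r32 (i j l m p : T) :
    brauer_rel w (fgen K i * fgen K j * fgen K l) (fgen K m * fgen K p) ->
    pgen P i * pgen P j * pgen P l = pgen P m * pgen P p.
  move/(@ppi_rel _ _ P) => h.
  exact: etrans (esym (g3 _ _ _)) (etrans h (g2 _ _)).
have r33 (i j l m p q : T) :
    brauer_rel w (fgen K i * fgen K j * fgen K l) (fgen K m * fgen K p * fgen K q) ->
    pgen P i * pgen P j * pgen P l = pgen P m * pgen P p * pgen P q.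
  move/(@ppi_rel _ _ P) => h.
  exact: etrans (esym (g3 _ _ _)) (etrans h (g3 _ _ _)).
have nextP a : (0 < a)%N -> (a.+1 < k)%N ->
    exists i j : 'I_k.-1, [/\ a = i.+1, a.+1 = j.+1 & j = i.+1 :> nat].
  move=> a0 ak.
  have /brauer_ordP[i ia] : (0 < a < k)%N by lia.
  have /brauer_ordP[j jb] : (0 < a.+1 < k)%N by lia.
  by exists i, j; split=> //; lia.
split.
- by move=> x; rewrite /GRing.comm -scalerAl -scalerAr mul1r mulr1.
- exact: bsigmaK.
- move=> a /brauer_ordP[i ->]; rewrite !beps_ord -scalerAl mul1r.
  have h := @ppi_rel _ _ P _ _ (brauer_ee w i).
  exact: etrans (esym (g2 _ _)) (etrans h (linearZ _ _)).
- by move=> a /brauer_ordP[i ->]; rewrite !beps_ord bsigma_ord; exact/r21/brauer_se.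
- by move=> a /brauer_ordP[i ->]; rewrite !beps_ord bsigma_ord; exact/r21/brauer_es.
- move=> a b a0 ab.
  have /brauer_ordP[i ia] : (0 < a < k)%N by lia.
  have /brauer_ordP[j jb] : (0 < b < k)%N by lia.
  have F : far i j by rewrite /far; lia.
  have F' : far j i by rewrite /far; lia.
  rewrite ia jb !beps_ord !bsigma_ord /GRing.comm.
  split; [exact/r22/brauer_ssC | exact/r22/brauer_eeC | exact/r22/brauer_seC |].
  exact/esym/r22/brauer_seC.
- move=> a a0 ak; have [i [j [ia jb ij]]] := nextP a a0 ak.
  rewrite jb ia !bsigma_ord; exact/r33/brauer_sss.
- move=> a a0 ak; have [i [j [ia jb ij]]] := nextP a a0 ak.
  rewrite jb ia !beps_ord !bsigma_ord.
  have see := r32 _ _ _ _ _ (brauer_see w ij); split=> //.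
  (* The second relation is [brauer_see] times [E a.+1] on the right, with
     [E a.+1 * E a * E a.+1 = E a.+1]. *)
  rewrite -see -!mulrA; congr (_ * _); rewrite mulrA.
  exact/r31/brauer_eee'.
- move=> a a0 ak; have [i [j [ia jb ij]]] := nextP a a0 ak.
  rewrite jb ia !beps_ord !bsigma_ord.
  have ees := r32 _ _ _ _ _ (brauer_ees w ij); split=> //.
  (* Likewise [brauer_ees] times [E a] on the left, with [E a * E a.+1 * E a = E a]. *)
  rewrite -mulrA -ees !mulrA; congr (_ * _).
  exact/r31/brauer_eee.
Qed.

Lemma comm_btau x a b : (forall c, (a <= c < b)%N -> GRing.comm x (S c)) ->
  GRing.comm x (btau k w a b) /\ GRing.comm x (btauV k w a b).
Proof.
move=> xS; split; rewrite /btau /btauV big_seq; apply: commr_prod => c.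
  by rewrite mem_index_iota; exact: xS.
by rewrite mem_rev mem_index_iota; exact: xS.
Qed.

(** [btau k w a n.+1] is [btau k w a n * S n], whose first factor commutes with [S n.+1]. For T = S
    and T = E this shows that conjugation by [S n.+1] raises the second index of [bsigma2] and
    [beps2]. *)
Lemma btau_conjS (T : nat -> brauer k w) a n : (0 < a <= n)%N -> (n.+1 < k)%N ->
  S n * T n.+1 * S n = S n.+1 * T n * S n.+1 ->
  btau k w a n.+1 * T n.+1 * btauV k w a n.+1 =
  S n.+1 * (btau k w a n * T n * btauV k w a n) * S n.+1.
Proof.
move=> /andP[a0 an] nk eqT.
have [t1 t2] : GRing.comm (S n.+1) (btau k w a n) /\
    GRing.comm (S n.+1) (btauV k w a n).
  apply: comm_btau => c cn; apply: commr_sym.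
  by have [||] := fam_far brauer_is_family (a := c) (b := n.+1); [lia..|].
have -> : btau k w a n.+1 = btau k w a n * S n by rewrite /btau big_nat_recr.
have -> : btauV k w a n.+1 = S n * btauV k w a n.
  rewrite /btauV /index_iota subSn // -addn1 iotaD rev_cat big_cat /= big_seq1.
  by rewrite subnKC.
by rewrite !mulrA t1 -!mulrA -t2 !mulrA -!(mulrA (btau _ _ _ _)) eqT.
Qed.

(** For n > 0 the summand a = n of y_(n+1) is [S n - E n]; the others come from y_n by conjugation
    with [S n]. *)
Lemma bjucysE n : (n < k)%N -> bjucys k w n.+1 = jucys S E n.
Proof.
elim: n => [|n IH] nk; first by rewrite /bjucys big_geq.
rewrite /= -IH /bjucys; last lia.
rewrite big_nat_recr //= /bsigma2 /beps2 /= /btau /btauV /index_iota subnn !big_nil.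
rewrite !mul1r !mulr1 addrA; congr (_ + _ - _).
rewrite conj_sumr; apply: eq_big_seq => a.
rewrite mem_iota => an; rewrite mulrBr mulrBl.
have nk1 : (n < k)%N by lia.
have n0 : (0 < n)%N by lia.
congr (_ - _).
  apply: (btau_conjS (T := S)) => //; first lia.
  exact: (fam_sss brauer_is_family).
apply: (btau_conjS (T := E)) => //; first lia.
have [h1 h2] := fam_ees brauer_is_family n0 nk.
have [h3 h4] := fam_see brauer_is_family n0 nk.
(* Both conjugates equal [S n * E n.+1 * E n * S n.+1]. *)
by rewrite -h3 -!mulrA [E _ * (E _ * _)]mulrA h1.
Qed.

Lemma brauer_symE : (0 < k)%N -> brauer_sym k w =
  ((k`!%:R)^-1 * \prod_(2 <= b < k.+1) (2 * b%:R + w - 4)^-1) *: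
    sym_prod w%:A S E k.-1.
Proof.

move=> k0; rewrite /brauer_sym -scalerA; congr (_ *: _).
have h n (F : nat -> K) (G : nat -> brauer k w) :
    \prod_(2 <= b < n.+2) (F b *: G b) =
    (\prod_(2 <= b < n.+2) F b) *: \prod_(i < n) G i.+2.
  elim: n => [|n IH]; first by rewrite !big_geq // big_ord0 scale1r.
  rewrite [LHS]big_nat_recr // [X in _ = X *: _]big_nat_recr //= IH big_ord_recr /=.
  by rewrite -scalerAl -scalerAr scalerA.
have -> : k.+1 = k.-1.+2 by rewrite prednK.
apply: etrans (h _ (fun b => (2 * b%:R + w - 4)^-1)
  (fun b => (bjucys k w b + 1) * (bjucys k w b + (w + b%:R - 3)%:A))) _.
congr (_ *: _); apply: eq_bigr => i _.
have ik := ltn_ord i; rewrite bjucysE; last lia.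
have -> : (w + i.+2%:R - 3)%:A = w%:A + i.+2%:R - 3 :> brauer k w.
  by rewrite scalerBl scalerDl !scaler_nat.
by [].
Qed.

Lemma brauer_sym_trivial a : (0 < a < k)%N ->
  [/\ S a * brauer_sym k w = brauer_sym k w,
      brauer_sym k w * S a = brauer_sym k w,
      E a * brauer_sym k w = 0 & brauer_sym k w * E a = 0].
Proof.
move=> ak; rewrite brauer_symE; last lia.
have kk : (k.-1 < k)%N by lia.
have ak' : (0 < a <= k.-1)%N by lia.
have [l1 l2] := sym_prod_trivial brauer_is_family kk ak'.
have [r1 r2] := sym_prod_trivialr brauer_is_family kk ak'.
by rewrite -!scalerAl -!scalerAr l1 l2 r1 r2 scaler0.
Qed.

Lemma brauer_aug_jucys n : (n < k)%N -> brauer_aug (jucys S E n) = n%:R.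
Proof.
elim: n => [|n IH] nk; first by rewrite raddf0.
rewrite /= raddfB raddfD /= !rmorphM /= brauer_aug_sigma ?brauer_aug_eps //.
by rewrite IH ?subr0 ?mul1r ?mulr1 ?natr1 //; lia.
Qed.

(** Since y_b has augmentation b - 1, the factor at b has augmentation b (2b + w - 4), which is what
    the scalars in [brauer_sym] cancel. *)
Lemma brauer_aug_sym : (0 < k)%N -> (k`!%:R : K) != 0 ->
  (forall b : nat, (2 <= b <= k)%N -> 2 * b%:R + w - 4 != 0) ->
  brauer_aug (brauer_sym k w) = 1.
Proof.
move=> k0 kf wb; rewrite brauer_symE // /brauer_aug paugZ -/(brauer_aug _).

pose X b : K := 2 * b%:R + w - 4.
have prodX n : \prod_(i < n) (i.+2%:R * X i.+2) =
    n.+1`!%:R * \prod_(2 <= b < n.+2) X b.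
  elim: n => [|n IH]; first by rewrite big_ord0 big_geq // mulr1.
  rewrite big_ord_recr IH [in RHS]big_nat_recr // [in RHS]factS natrM /=.
  by rewrite mulrACA [_ * n.+2%:R]mulrC.
have augX (i : 'I_k.-1) : brauer_aug ((jucys S E i.+1 + 1) *
    (jucys S E i.+1 + (w%:A + i.+2%:R - 3))) = i.+2%:R * X i.+2.
  have ik := ltn_ord i.
  have augc : brauer_aug (w%:A + i.+2%:R - 3 : brauer k w) = w + i.+2%:R - 3.
    have augw : brauer_aug (w%:A : brauer k w) = w.
      by rewrite /brauer_aug paugZ rmorph1 mulr1.
    by rewrite rmorphB rmorphD !rmorph_nat -[in RHS]augw.
  have split_aug (y c : brauer k w) :
      brauer_aug ((y + 1) * (y + c)) =
        (brauer_aug y + 1) * (brauer_aug y + brauer_aug c).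
    by rewrite rmorphM !rmorphD rmorph1.
  rewrite split_aug augc brauer_aug_jucys; last lia.
  rewrite /X -!natr1; ring.
rewrite rmorph_prod (eq_bigr _ (fun i _ => augX i)) prodX.
have -> : k.-1.+1 = k by lia.
rewrite prodfV mulrACA mulVf // mul1r mulVf // prodf_seq_neq0.
by apply/allP => b; rewrite mem_index_iota ltnS; exact: wb.
Qed.

End BrauerSymmetrizer.

(** * Tensor representations *)

Section Lifting.
Variables (K : fieldType) (k n : nat).
Local Notation D := (tdim k n).

Lemma opatD (a b : nat) (T U : 'M[K]_(n * n)) :
  opat k a b (T + U) = opat k a b T + opat k a b U.
Proof.
rewrite /opat -big_split; apply: eq_bigr => i _; rewrite -big_split.
by apply: eq_bigr => j _; apply/matrixP => p q; rewrite !mxE /= mxE mulrnDl.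
Qed.

Lemma opatZ (a b : nat) c (T : 'M[K]_(n * n)) :
  opat k a b (c *: T) = c *: opat k a b T.
Proof.
rewrite /opat scaler_sumr; apply: eq_bigr => i _; rewrite scaler_sumr.
by apply: eq_bigr => j _; apply/matrixP => p q; rewrite !mxE /= mxE mulrnAr.
Qed.

Lemma opat1 (a : nat) : (0 < a < k)%N -> opat k a a.+1 (1%:M : 'M[K]_(n * n)) = 1.
Proof.
move=> ak; have ak1 : (a.-1 < k)%N by lia.
have ak2 : (a < k)%N by lia.
have -> : opat k a a.+1 (1%:M : 'M[K]_(n * n)) =
    opat_ord (Ordinal ak1) (Ordinal ak2) 1%:M.
  by rewrite -opatE /= prednK //; lia.
apply: entP => I J; rewrite ent_opat /ent !mxE.
rewrite (inj_eq (can_inj (@mxtens_indexK n n))) xpair_eqE (inj_eq enum_rank_inj).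
rewrite -mulrnA mulnb; congr (_ %:R); congr nat_of_bool.
apply/idP/eqP => [/andP[/andP[/eqP h1 /eqP h2] /forallP h3]|->].
  apply/ffunP => c; have := h3 c.
  case: (eqVneq c (Ordinal ak1)) => [->|_] //.
  by case: (eqVneq c (Ordinal ak2)) => [->|_ /eqP].
by rewrite !eqxx /=; apply/forallP => c; rewrite eqxx implybT.
Qed.

(** * Jucys-Murphy elements in a sign-twisted representation *)

Section Twisted.
Variables (h : K) (th : 'I_n -> K).
Hypothesis h2 : h * h = 1.
Hypothesis th2 : forall i, th i * th i = 1.
Hypothesis threv : forall i, th (rev_ord i) = h * th i.
Variables (w : K) (phi : {rmorphism brauer k w -> 'M[K]_D}).
Hypothesis phiZ : forall c u, phi (c *: u) = c *: phi u.
Hypothesis phiS : forall a, (0 < a < k)%N ->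
  phi (bsigma k w a) = h *: opat k a a.+1 (Pop n).
Hypothesis phiE : forall a, (0 < a < k)%N ->
  phi (beps k w a) = h *: opat k a a.+1 (Qth th).

(** Conjugation by a permutation operator renames the tensor factors, here b into b + 1. *)
Lemma opat_conj a b : (0 < a < b)%N -> (b < k)%N ->
  opat k b b.+1 (Pop n) * (opat k a b (Pop n) - opat k a b (Qth th)) *
    opat k b b.+1 (Pop n) =
  opat k a b.+1 (Pop n) - opat k a b.+1 (Qth th) :> 'M[K]_D.
Proof.
case: a => // a; case: b => // b /andP[_ ab] bk; rewrite ltnS in ab.
have ak : (a < k)%N by lia.
have bk' : (b < k)%N by lia.
pose i := Ordinal ak; pose j := Ordinal bk'; pose l := Ordinal bk.
have ij : i != j by rewrite -val_eqE /=; lia.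
have jl : j != l by rewrite -val_eqE /=; lia.
have il : i != l by rewrite -val_eqE /=; lia.
rewrite -[a]/(val i) -[b.+1]/(val l) -[b.+2]/(val l).+1.
have jlE (T : 'M[K]_(n * n)) : opat k (val l) (val l).+1 T = opat_ord j l T.
  exact: (opatE j l).
have ijE (T : 'M[K]_(n * n)) : opat k (val i).+1 (val l) T = opat_ord i j T.
  exact: (opatE i j).
rewrite jlE !ijE !opatE !opat_Pop // mulrBr mulrBl !permopM; congr (_ - _).
  by congr permop; rewrite -{1}tpermV -conjgE tpermJ tpermL tpermD // eq_sym.
rewrite -/(Qm th i j) permQ // -mulrA permopM tperm2 permop1 mulr1.
by rewrite tpermL tpermD // eq_sym.
Qed.

(** Conjugation by [h *: Pop n] costs [h * h = 1], so the recursion of [jucys] carries a single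
    factor [h] along. *)
Lemma rep_jucys m : (m < k)%N -> phi (bjucys k w m.+1) =
  h *: \sum_(1 <= a < m.+1) (opat k a m.+1 (Pop n) - opat k a m.+1 (Qth th)).
Proof.
move=> mk; rewrite bjucysE //; elim: m mk => [|m IH] mk.
  by rewrite big_geq // raddf0 scaler0.
have m0 : (0 < m.+1 < k)%N by lia.
rewrite /= rmorphB rmorphD !rmorphM IH; last lia.
rewrite phiS // phiE // [in RHS]big_nat_recr //= !scalerDr scalerN addrA.
congr (_ + _ - _).
rewrite !sscaleAl !sscaleAr !scalerA h2 scale1r sscaleAl; congr (_ *: _).
rewrite conj_sumr; apply: eq_big_nat => a am; rewrite opat_conj //.
Qed.

Lemma rep_sym : phi (brauer_sym k w) = (k`!%:R)^-1 *: \prod_(2 <= b < k.+1)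
  ((2 * b%:R + w - 4)^-1 *:
     ((phi (bjucys k w b) + 1) * (phi (bjucys k w b) + (w + b%:R - 3)%:M))).
Proof.
rewrite /brauer_sym phiZ rmorph_prod; congr (_ *: _); apply: eq_bigr => b _.
have split_phi (y : brauer k w) c :
    phi ((y + 1) * (y + c%:A)) = (phi y + 1) * (phi y + c%:M).
  by rewrite rmorphM !rmorphD rmorph1 phiZ rmorph1 scalemx1.
by rewrite phiZ split_phi.
Qed.

End Twisted.
End Lifting.

(** * Vectors on which the Brauer algebra acts through its augmentation *)

Section TrivialAction.
Variables (K : fieldType) (k : nat) (w : K).
Local Notation S := (bsigma k w).
Local Notation E := (beps k w).

(** The symmetrizer is a polynomial in the generators, so a property closed under the algebra
    operations need only be checked on them. *)
Lemma brauer_sym_ind (P : brauer k w -> Prop) :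
  P 1 -> (forall u v, P u -> P v -> P (u + v)) ->
  (forall u v, P u -> P v -> P (u * v)) -> (forall c u, P u -> P (c *: u)) ->
  (forall a, (0 < a < k)%N -> P (S a)) -> (forall a, (0 < a < k)%N -> P (E a)) ->
  P (brauer_sym k w).
Proof.
move=> P1 PD PM PZ PS PE.
have PJ m : (m < k)%N -> P (jucys S E m).
  elim: m => [|m IH] mk; first by rewrite /= -(scale0r (1 : brauer k w)); exact: PZ.
  rewrite /= -scaleN1r; apply: (PD); last exact/PZ/PE.
  by apply: (PD); [apply: (PM); [apply: (PM)|]; [|apply: IH; lia|] |]; apply: PS.
apply: (PZ); rewrite big_seq; apply: (big_ind P) => // b; rewrite mem_index_iota => bk.
have Pb : P (bjucys k w b).
  by case: b bk => // b bk; rewrite bjucysE; [apply: PJ|]; lia.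
by apply/PZ/PM; apply: PD => //; exact: PZ.
Qed.

(* The idempotent of the Brauer algebra on two strands complementary to its
   symmetrizer; it represents both B_n and 1 - \widetilde B_n. *)
Definition brauer_compl (a : nat) : brauer k w := 2^-1 *: (1 - S a) + w^-1 *: E a.

(** [2^-1 *: (1 - S a)] and [w^-1 *: E a] are orthogonal idempotents, so their sum acts as the
    identity on multiples of each. *)
Lemma brauer_compl_gens a : (2 : K) != 0 -> w != 0 -> (0 < a < k)%N ->
  [/\ brauer_compl a * E a = E a, E a * brauer_compl a = E a,
      brauer_compl a * (1 - S a) = 1 - S a & (1 - S a) * brauer_compl a = 1 - S a].
Proof.
move=> two w0 ak; have fam := brauer_is_family k w.
have ss := fam_ss fam ak; have se := fam_se fam ak; have es := fam_es fam ak.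
have ee : E a * E a = w *: E a by rewrite (fam_ee fam) // -scalerAl mul1r.
rewrite /brauer_compl.
have ds : (1 - S a) * (1 - S a) = 2 *: (1 - S a).
  by rewrite mulrBl mul1r mulrBr mulr1 ss scaler_nat mulr2n opprB.
have dE : (1 - S a) * E a = 0 by rewrite mulrBl mul1r se subrr.
have Ed : E a * (1 - S a) = 0 by rewrite mulrBr mulr1 es subrr.
split.
- by rewrite mulrDl -!scalerAl dE ee scaler0 add0r scalerA mulVf // scale1r.
- by rewrite mulrDr -!scalerAr Ed ee scaler0 add0r scalerA mulVf // scale1r.
- by rewrite mulrDl -!scalerAl ds Ed scaler0 addr0 scalerA mulVf // scale1r.
- by rewrite mulrDr -!scalerAr ds dE scaler0 addr0 scalerA mulVf // scale1r.
Qed.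

Lemma brauer_compl_sym a : (0 < a < k)%N ->
  brauer_compl a * brauer_sym k w = 0 /\ brauer_sym k w * brauer_compl a = 0.
Proof.
move=> ak; have [ss sS es sE] := brauer_sym_trivial w ak.
rewrite /brauer_compl; split.
  by rewrite mulrDl -!scalerAl mulrBl mul1r ss es subrr !scaler0 addr0.
by rewrite mulrDr -!scalerAr mulrBr mulr1 sS sE subrr !scaler0 addr0.
Qed.

Section Lift.
Variable n : nat.
Local Notation D := (tdim k n).
Variable phi : {rmorphism brauer k w -> 'M[K]_D}.
Hypothesis phiZ : forall c u, phi (c *: u) = c *: phi u.
Hypotheses (two : (2 : K) != 0) (w0 : w != 0).
Hypotheses (k0 : (0 < k)%N) (kf : (k`!%:R : K) != 0).
Hypothesis wb : forall b : nat, (2 <= b <= k)%N -> 2 * b%:R + w - 4 != 0.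
Variable B : algType K.
Local Notation lft u := (lift_op B (phi u)).

Lemma lift1 : lft 1 = 1%:M.
Proof. by rewrite rmorph1 /lift_op map_mx1. Qed.

Lemma liftD u v : lft (u + v) = lft u + lft v.
Proof. by rewrite rmorphD /lift_op map_mxD. Qed.

Lemma liftM u v : lft (u * v) = lft u *m lft v.
Proof. by rewrite rmorphM /lift_op map_mxM. Qed.

Lemma lift_row c u (V : 'rV[B]_D) : V *m lft (c *: u) = c%:A *: (V *m lft u).
Proof.
apply/matrixP => i j; rewrite phiZ !mxE mulr_sumr; apply: eq_bigr => p _.
rewrite !mxE !in_algE -!scalerAl -!scalerAr !mulr1 !mul1r scalerA //.
Qed.

Lemma lift_col c u (V : 'cV[B]_D) : lft (c *: u) *m V = c%:A *: (lft u *m V).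
Proof.
apply/matrixP => i j; rewrite phiZ !mxE mulr_sumr; apply: eq_bigr => p _.
rewrite !mxE !in_algE -!scalerAl !mul1r scalerA //.
Qed.

Lemma scaler_algA m p (c d : K) (M : 'M[B]_(m, p)) :
  c%:A *: (d%:A *: M) = (c * d)%:A *: M.
Proof.
have -> : (c * d)%:A = c%:A * d%:A :> B by rewrite -scalerAl mul1r scalerA.
by rewrite scalerA.
Qed.

Lemma row_fixed (V : 'rV[B]_D) :
  (forall a, (0 < a < k)%N -> V *m lft (brauer_compl a) = 0) ->
  V *m lft (brauer_sym k w) = V.
Proof.
move=> V0.
suff : V *m lft (brauer_sym k w) = (brauer_aug (brauer_sym k w))%:A *: V.
  by rewrite brauer_aug_sym // !scale1r.
(* Applied to [1 - S a] and [E a], which therefore annihilate [V] as well. *)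
have V0r u a : (0 < a < k)%N -> brauer_compl a * u = u -> V *m lft u = 0.
  by move=> ak <-; rewrite liftM mulmxA V0 // mul0mx.
apply: (brauer_sym_ind (P := fun u => V *m lft u = (brauer_aug u)%:A *: V))
  => [|u v hu hv|u v hu hv|c u hu|a ak|a ak].
- by rewrite lift1 mulmx1 rmorph1 !scale1r.
- by rewrite liftD mulmxDr hu hv rmorphD !scalerDl.
- by rewrite liftM mulmxA hu -scalemxAl hv rmorphM scaler_algA.
- by rewrite lift_row hu /brauer_aug paugZ scaler_algA.
- have [_ _ h _] := brauer_compl_gens two w0 ak.
  apply/eqP; rewrite brauer_aug_sigma // !scale1r eq_sym -subr_eq0; apply/eqP.
  rewrite -(V0r _ _ ak h) liftD mulmxDr lift1 mulmx1.
  by rewrite -[in RHS]scaleN1r lift_row !scaleN1r.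
- have [h _ _ _] := brauer_compl_gens two w0 ak.
  by rewrite brauer_aug_eps // !scale0r (V0r _ _ ak h).
Qed.

Lemma col_fixed (V : 'cV[B]_D) :
  (forall a, (0 < a < k)%N -> lft (brauer_compl a) *m V = 0) ->
  lft (brauer_sym k w) *m V = V.
Proof.

move=> V0.
suff : lft (brauer_sym k w) *m V = (brauer_aug (brauer_sym k w))%:A *: V.
  by rewrite brauer_aug_sym // !scale1r.
have V0r u a : (0 < a < k)%N -> u * brauer_compl a = u -> lft u *m V = 0.
  by move=> ak <-; rewrite liftM -mulmxA V0 // mulmx0.
apply: (brauer_sym_ind (P := fun u => lft u *m V = (brauer_aug u)%:A *: V))
  => [|u v hu hv|u v hu hv|c u hu|a ak|a ak].
- by rewrite lift1 mul1mx rmorph1 !scale1r.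
- by rewrite liftD mulmxDl hu hv rmorphD !scalerDl.
- rewrite liftM -mulmxA hv.
  (* [B] need not be commutative, so the scalar in front of [V] is absorbed into the Brauer algebra,
     where it moves past [u]. *)
  have -> : (brauer_aug v)%:A *: V = lft (brauer_aug v *: 1) *m V.
    by rewrite lift_col lift1 mul1mx.
  rewrite mulmxA -liftM -scalerAr mulr1 lift_col hu scaler_algA rmorphM mulrC //.
- by rewrite lift_col hu /brauer_aug paugZ scaler_algA.
- have [_ _ _ h] := brauer_compl_gens two w0 ak.
  apply/eqP; rewrite brauer_aug_sigma // !scale1r eq_sym -subr_eq0; apply/eqP.
  rewrite -(V0r _ _ ak h) liftD mulmxDl lift1 mul1mx.
  by rewrite -[in RHS]scaleN1r lift_col !scaleN1r.
- have [_ h _ _] := brauer_compl_gens two w0 ak.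
  by rewrite brauer_aug_eps // !scale0r (V0r _ _ ak h).
Qed.

End Lift.
End TrivialAction.

(** * Products of generators and operators on adjacent tensor factors *)

Section QuadraticTensors.
Variables (K : fieldType) (k n : nat) (B : algType K) (x : 'I_n -> B).
Local Notation D := (tdim k n).
Local Notation mi := (multi k n).

Lemma upd_l (J : mi) (a b : 'I_k) i j : upd J a b i j a = i.
Proof. by rewrite ffunE eqxx. Qed.

Lemma upd_r (J : mi) (a b : 'I_k) i j : a != b -> upd J a b i j b = j.
Proof. by move=> ab; rewrite ffunE eq_sym (negPf ab) eqxx. Qed.

(** Adjacency keeps the two letters together in a noncommutative product; [L] and [R] collect the
    letters before and after them. *)
Lemma prod_upd (a b : 'I_k) (J : mi) : b = a.+1 :> nat ->
  exists L R, forall i j,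
    \prod_(c < k) x (upd J a b i j c) = L * (x i * x j) * R.
Proof.
move=> ba.
(* The value 1 out of range extends the letters to all natural numbers, so that the product can be
   cut at [a] and [b.+1]. *)
pose g (I : mi) c : B := if insub c is Some c' then x (I c') else 1.
exists (\prod_(0 <= c < a) g J c), (\prod_(b.+1 <= c < k) g J c) => i j.
have gE (I : mi) : \prod_(c < k) x (I c) = \prod_(0 <= c < k) g I c.
  by rewrite big_mkord; apply: eq_bigr => c _; rewrite /g valK.
have gJ (c : nat) : (c != a) -> (c != b) -> g (upd J a b i j) c = g J c.
  move=> ca cb; rewrite /g; case: insubP => // c' _ c'E.
  by rewrite ffunE -!val_eqE c'E /= (negPf ca) (negPf cb).
have ab : b != a by rewrite -val_eqE /= ba; lia.
have bk := ltn_ord b.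
rewrite gE (big_cat_nat (n := a)) //=; last lia.
rewrite (big_cat_nat (m := a) (n := b.+1)) //=; try lia.
rewrite [X in _ * (X * _)]big_ltn; last lia.
rewrite -ba big_nat1 mulrA.
have -> : g (upd J a b i j) a = x i by rewrite /g valK upd_l.
have -> : g (upd J a b i j) b = x j by rewrite /g valK upd_r // eq_sym.
congr (_ * _ * _); apply: eq_big_nat => c cP; apply: gJ; lia.
Qed.

(** The condition singles out the multi-indices that [opat_ord a b T] can link to [J]. *)
Lemma sum_upd (a b : 'I_k) (J : mi) (F : mi -> B) : a != b ->
  \sum_(I : mi | [forall c, (c != a) && (c != b) ==> (I c == J c)]) F I =
  \sum_i \sum_j F (upd J a b i j).
Proof.
move=> ab; rewrite pair_bigA /=.
rewrite (reindex_onto (fun p => upd J a b p.1 p.2) (fun I : mi => (I a, I b))) /=.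
  apply: eq_bigl => -[i j] /=; rewrite upd_l upd_r // eqxx andbT.
  by apply/forallP => c; apply/implyP => /andP[ca cb]; rewrite ffunE (negPf ca) (negPf cb).
move=> I /forallP IJ; apply/ffunP => c; rewrite ffunE.
case: (eqVneq c a) => [-> //|ca]; case: (eqVneq c b) => [-> //|cb].
by have := IJ c; rewrite ca cb => /eqP.
Qed.

Lemma ord_nextP a : (0 < a < k)%N ->
  exists i j : 'I_k, [/\ a = i.+1, j = i.+1 :> nat & i != j].
Proof.
move=> ak; have ak1 : (a.-1 < k)%N by lia.
have ak2 : (a < k)%N by lia.
by exists (Ordinal ak1), (Ordinal ak2); split; rewrite -?val_eqE /=; lia.
Qed.

(** By [prod_upd] each entry is L times a quadratic relation times R. *)
Lemma tens_row_opat (T : 'M[K]_(n * n)) a : (0 < a < k)%N ->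
  (forall l m, \sum_i \sum_j mxent T i j l m *: (x i * x j) = 0) ->
  tens_row k x *m lift_op B (opat k a a.+1 T) = 0.
Proof.
move=> /ord_nextP[ia [ib [-> ba ab]]] T0.
have -> : opat k ia.+1 ia.+2 T = opat_ord ia ib T by rewrite -opatE ba.
apply/matrixP => z q; rewrite !mxE; set J := enum_val q.
have [L [R LR]] := prod_upd J ba.
transitivity (\sum_(I : mi) (\prod_(c < k) x (I c) *
   (mxent T (I ia) (I ib) (J ia) (J ib))%:A) *+
     [forall c, (c != ia) && (c != ib) ==> (I c == J c)]).
  rewrite (reindex (@enum_rank mi)); last exact: onW_bij (@enum_rank_bij mi).
  apply: eq_bigr => I _; rewrite !mxE enum_rankK in_algE -/J /mxent.
  by rewrite -scalerMnl mulrnAr.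
under eq_bigr do rewrite mulrb.
rewrite -big_mkcond sum_upd //=.
transitivity (L * (\sum_i \sum_j mxent T i j (J ia) (J ib) *: (x i * x j)) * R);
  last by rewrite T0 mulr0 mul0r.
rewrite mulr_sumr mulr_suml; apply: eq_bigr => i _.
rewrite mulr_sumr mulr_suml; apply: eq_bigr => j _.
rewrite LR upd_l (upd_r _ _ _ ab).
by rewrite -!scalerAr mulr1 scalerAl.
Qed.

Lemma tens_col_opat (T : 'M[K]_(n * n)) a : (0 < a < k)%N ->
  (forall i j, \sum_l \sum_m mxent T i j l m *: (x l * x m) = 0) ->
  lift_op B (opat k a a.+1 T) *m tens_col k x = 0.
Proof.
move=> /ord_nextP[ia [ib [-> ba ab]]] T0.
have -> : opat k ia.+1 ia.+2 T = opat_ord ia ib T by rewrite -opatE ba.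
apply/matrixP => q z; rewrite !mxE; set J := enum_val q.
have [L [R LR]] := prod_upd J ba.
transitivity (\sum_(I : mi) ((mxent T (J ia) (J ib) (I ia) (I ib))%:A *
   \prod_(c < k) x (I c)) *+
     [forall c, (c != ia) && (c != ib) ==> (I c == J c)]).
  rewrite (reindex (@enum_rank mi)); last exact: onW_bij (@enum_rank_bij mi).
  apply: eq_bigr => I _; rewrite !mxE enum_rankK in_algE -/J /mxent.
  rewrite -scalerMnl mulrnAl; congr (_ *+ nat_of_bool _).
  by apply: eq_forallb => c; rewrite [J c == _]eq_sym.
under eq_bigr do rewrite mulrb.
rewrite -big_mkcond sum_upd //=.
transitivity (L * (\sum_l \sum_m mxent T (J ia) (J ib) l m *: (x l * x m)) * R);
  last by rewrite T0 mulr0 mul0r.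
rewrite mulr_sumr mulr_suml; apply: eq_bigr => i _.
rewrite mulr_sumr mulr_suml; apply: eq_bigr => j _.
rewrite LR upd_l (upd_r _ _ _ ab).
by rewrite -!scalerAl mul1r -scalerAr -scalerAl.
Qed.

End QuadraticTensors.

Lemma ppi_quadratic (K : fieldType) (n : nat) (P : presentation K 'I_n)
    (c : 'I_n -> 'I_n -> K) :
  ppi P (\sum_i \sum_j c i j *: (fgen K i * fgen K j)) =
  \sum_i \sum_j c i j *: (pgen P i * pgen P j).
Proof.
rewrite raddf_sum; apply: eq_bigr => i _; rewrite raddf_sum; apply: eq_bigr => j _.
apply: etrans (linearZ _ _) _; congr (_ *: _); exact: rmorphM.
Qed.

(** * Quadratic relations of the four algebras *)

Section QuadraticRelations.
Variables (K : fieldType) (n : nat) (A : 'M[K]_(n * n)).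

Lemma X_quadratic k l : let x := pgen (X_pres A) in
  \sum_i \sum_j mxent A k l i j *: (x i * x j) = 0.
Proof.
rewrite /= -(ppi_quadratic (X_pres A) (fun i j => mxent A k l i j)).
rewrite -(raddf0 (ppi (X_pres A))).
apply: ppi_rel; exact: X_Rel.
Qed.

Lemma Xd_quadratic k l : let x := pgen (Xd_pres A) in
  \sum_i \sum_j mxent A i j k l *: (x i * x j) = 0.
Proof.
rewrite /= -(ppi_quadratic (Xd_pres A) (fun i j => mxent A i j k l)).
rewrite -(raddf0 (ppi (Xd_pres A))).
apply: ppi_rel; exact: Xd_Rel.
Qed.

Lemma mxent_compl i j k l :
  mxent (1%:M - A) i j k l = ((i == k) && (j == l))%:R - mxent A i j k l.
Proof.
by rewrite /mxent !mxE (inj_eq (can_inj (@mxtens_indexK n n))) xpair_eqE.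
Qed.

Lemma sum_delta (B : lmodType K) (F : 'I_n -> 'I_n -> B) k l :
  \sum_i \sum_j ((i == k) && (j == l))%:R *: F i j = F k l.
Proof.
rewrite (bigD1 k) //= (bigD1 l) //= !eqxx scale1r !big1 ?addr0 // => [i ik|j jl].
  by rewrite big1 // => j _; rewrite (negPf ik) scale0r.
by rewrite (negPf jl) andbF scale0r.
Qed.

(** The defining relation is recast as annihilation by [1%:M - A], the form that [tens_row_opat]
    requires. *)
Lemma Xi_quadratic k l : let x := pgen (Xi_pres A) in
  \sum_i \sum_j mxent (1%:M - A) i j k l *: (x i * x j) = 0.
Proof.
move=> x; have rel : x k * x l = \sum_i \sum_j mxent A i j k l *: (x i * x j).
  rewrite -(ppi_quadratic (Xi_pres A) (fun i j => mxent A i j k l)).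
  apply: etrans (esym (rmorphM _ _ _)) _; apply: ppi_rel; exact: Xi_Rel.
under eq_bigr do under eq_bigr do rewrite mxent_compl scalerBl.
under eq_bigr do rewrite sumrB.
by rewrite sumrB sum_delta rel subrr.
Qed.

Lemma Xid_quadratic k l : let x := pgen (Xid_pres A) in
  \sum_i \sum_j mxent (1%:M - A) k l i j *: (x i * x j) = 0.
Proof.
move=> x; have rel : x k * x l = \sum_i \sum_j mxent A k l i j *: (x i * x j).
  rewrite -(ppi_quadratic (Xid_pres A) (fun i j => mxent A k l i j)).
  apply: etrans (esym (rmorphM _ _ _)) _; apply: ppi_rel; exact: Xid_Rel.
under eq_bigr do under eq_bigr do
  rewrite mxent_compl scalerBl [k == _]eq_sym [l == _]eq_sym.
under eq_bigr do rewrite sumrB.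
by rewrite sumrB sum_delta rel subrr.
Qed.

End QuadraticRelations.

(** * The S- and A-operators as images of the symmetrizer *)

Section Operators.
Variables (K : fieldType) (k n : nat).
Local Notation D := (tdim k n).
Variables (h : K) (th : 'I_n -> K).
Variables (w : K) (phi : {rmorphism brauer k w -> 'M[K]_D}).
Hypothesis phiZ : forall c u, phi (c *: u) = c *: phi u.
Hypothesis phiS : forall a, (0 < a < k)%N ->
  phi (bsigma k w a) = h *: opat k a a.+1 (Pop n).
Hypothesis phiE : forall a, (0 < a < k)%N ->
  phi (beps k w a) = h *: opat k a a.+1 (Qth th).
Hypotheses (two : (2 : K) != 0) (w0 : w != 0).
Hypotheses (k0 : (0 < k)%N) (kf : (k`!%:R : K) != 0).
Hypothesis wb : forall b : nat, (2 <= b <= k)%N -> 2 * b%:R + w - 4 != 0.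

(** Represents [brauer_compl] on two tensor factors. With the matching signs [th] it is [Bop n] for
    h = 1, w = n, and [1%:M - Btop r] for h = -1, w = -2r. *)
Definition twisted_compl : 'M[K]_(n * n) :=
  2^-1 *: (1%:M - h *: Pop n) + (w^-1 * h) *: Qth th.

Lemma opat_compl a : (0 < a < k)%N ->
  opat k a a.+1 twisted_compl = phi (brauer_compl k w a).
Proof.
move=> ak; rewrite /twisted_compl -scaleNr !(opatD, opatZ) opat1 //.
by rewrite /brauer_compl rmorphD !phiZ rmorphB rmorph1 phiS // phiE // scalerA scaleNr.
Qed.

Lemma S_operator_sym (A : 'M[K]_(n * n)) : A = twisted_compl ->
  is_S_operator A (phi (brauer_sym k w)).
Proof.
move=> AT; split=> [a ak||].
- rewrite AT opat_compl // !mulmxE -!rmorphM.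
  by have [-> ->] := brauer_compl_sym w ak; rewrite raddf0.
- apply: row_fixed => // a ak; rewrite -opat_compl // -AT.
  by apply: tens_row_opat => // l m; exact: Xd_quadratic.
- apply: col_fixed => // a ak; rewrite -opat_compl // -AT.
  by apply: tens_col_opat => // l m; exact: X_quadratic.
Qed.

Lemma A_operator_sym (A : 'M[K]_(n * n)) : 1%:M - A = twisted_compl ->
  is_A_operator A (phi (brauer_sym k w)).
Proof.
move=> AT; split=> [a ak||].
- rewrite AT opat_compl // !mulmxE -!rmorphM.
  by have [-> ->] := brauer_compl_sym w ak; rewrite raddf0.
- apply: row_fixed => // a ak; rewrite -opat_compl // -AT.
  by apply: tens_row_opat => // l m; exact: Xi_quadratic.
- apply: col_fixed => // a ak; rewrite -opat_compl // -AT.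
  by apply: tens_col_opat => // l m; exact: Xid_quadratic.
Qed.

End Operators.

Local Open Scope complex_scope.

Theorem proposition7p10 (R : realType) (k : nat) (hk : (2 <= k)%N) :
  (forall w : R[i],
     (forall b : nat, (2 <= b <= k)%N -> 2 * b%:R + w - 4 != 0) ->
     (forall a : nat, (1 <= a < k)%N ->
        [/\ bsigma k w a * brauer_sym k w = brauer_sym k w,
            brauer_sym k w * bsigma k w a = brauer_sym k w,
            beps k w a * brauer_sym k w = 0
          & brauer_sym k w * beps k w a = 0])
     /\ brauer_aug (brauer_sym k w) = 1)
  /\
  (forall n : nat, (0 < n)%N ->
     let S : 'M[R[i]]_(tdim k n) := rho (brauer_sym k n%:R) in
     S = (k`!%:R)^-1 *: \prod_(2 <= b < k.+1)
           ((2 * b%:R + n%:R - 4)^-1 *: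
              ((Yop k n b + 1) * (Yop k n b + (n%:R + b%:R - 3)%:M)))
     /\ is_S_operator (Bop n) S)
  /\
  (forall r : nat, (k <= r.+1)%N ->
     let A : 'M[R[i]]_(tdim k (2 * r)) := rhot (brauer_sym k (- (2 * r)%:R)) in
     A = (k`!%:R)^-1 *: \prod_(2 <= b < k.+1)
           ((2 * b%:R - (2 * r)%:R - 4)^-1 *:
              ((Ytop k r b + 1) * (Ytop k r b + (- (2 * r)%:R + b%:R - 3)%:M)))
     /\ is_A_operator (Btop r) A).
Proof.
have two : (2 : R[i]) != 0 by rewrite pnatr_eq0.
have kf : (k`!%:R : R[i]) != 0 by rewrite pnatr_eq0 -lt0n fact_gt0.
have k0 : (0 < k)%N by exact: ltnW.
split=> [w wb|].
  by split=> [a ak|]; [exact: brauer_sym_trivial | exact: brauer_aug_sym].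
split=> [n n0|r kr] /=.
- have w0 : (n%:R : R[i]) != 0 by rewrite pnatr_eq0 -lt0n.
  have wb b : (2 <= b <= k)%N -> (2 * b%:R + n%:R - 4 : R[i]) != 0.
    (* As b is at least 2, 2b + n - 4 is a natural number and at least n > 0. *)
    move=> bk; rewrite -natrM -natrD -natrB ?pnatr_eq0; lia.
  have phiS a : (0 < a < k)%N -> rho (bsigma k n%:R a) =
      1 *: opat k a a.+1 (Pop n) :> 'M[R[i]]_(tdim k n).
    by move=> ak; rewrite rho_sigma // scale1r.
  have phiE a : (0 < a < k)%N -> rho (beps k n%:R a) =
      1 *: opat k a a.+1 (Qth (fun=> 1)) :> 'M[R[i]]_(tdim k n).
    by move=> ak; rewrite rho_eps // scale1r Qth1.
  split.
    rewrite rep_sym; last exact: rho_is_scalable.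
    congr (_ *: _); apply: eq_big_nat => b bk.
    have <- // : rho (bjucys k n%:R b) = Yop k n b :> 'M[R[i]]_(tdim k n).
    case: b bk => // b bk; rewrite (rep_jucys _ phiS phiE) ?mulr1 //; last lia.
    by rewrite scale1r Qth1.
  apply: (S_operator_sym _ phiS phiE two w0 k0 kf wb); first exact: rho_is_scalable.
  by rewrite /Bop /twisted_compl Qth1 scale1r mulr1.
have r0 : (0 < r)%N by lia.
have w0 : (- (2 * r)%:R : R[i]) != 0 by rewrite oppr_eq0 pnatr_eq0; lia.
have wb b : (2 <= b <= k)%N -> (2 * b%:R - (2 * r)%:R - 4 : R[i]) != 0.
  (* The bound b <= k <= r + 1 makes 2r + 4 - 2b a natural number and at least 2. *)
  move=> bk; rewrite -addrA -opprD -natrM -natrD -opprB -natrB ?oppr_eq0 ?pnatr_eq0; lia.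
have phiS a : (0 < a < k)%N -> rhot (bsigma k (- (2 * r)%:R) a) =
    -1 *: opat k a a.+1 (Pop (2 * r)) :> 'M[R[i]]_(tdim k (2 * r)).
  by move=> ak; rewrite rhot_sigma // scaleN1r.
have phiE a : (0 < a < k)%N -> rhot (beps k (- (2 * r)%:R) a) =
    -1 *: opat k a a.+1 (Qth (@sgnC _ r)) :> 'M[R[i]]_(tdim k (2 * r)).
  by move=> ak; rewrite rhot_eps // scaleN1r.
split.
  rewrite rep_sym; last exact: rhot_is_scalable.
  congr (_ *: _); apply: eq_big_nat => b bk.
  have <- // : rhot (bjucys k (- (2 * r)%:R) b) =
      Ytop k r b :> 'M[R[i]]_(tdim k (2 * r)).
  case: b bk => // b bk; rewrite (rep_jucys _ phiS phiE) ?mulrNN ?mulr1 //; last lia.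
  by rewrite scaleN1r.
apply: (A_operator_sym _ phiS phiE two w0 k0 kf wb); first exact: rhot_is_scalable.
(* Both sides are (1 + P)/2 + Q/(2r), with [Qtop r] as Q. *)
rewrite /Btop /twisted_compl -/(Qth (@sgnC _ r)).
rewrite invrN mulrNN mulr1 scaleN1r opprK opprD opprK addrA; congr (_ + _).
rewrite scalerBr scalerDr opprB addrCA addrC; congr (_ + _).
rewrite -[X in X - _]scale1r -scalerBl; congr (_ *: _).
by rewrite {1}[1](splitr 1) mul1r addrK.
Qed.
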